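(* Let $K\subset\mathbb{R}^n$ and let $\{T_t\}_{t\in[0,1]}$ be a continuously contracting family of maps $T_t:K\to\mathbb{R}^n$ (so $T_0$ is the identity on $K$) with smooth trajectories, i.e. $t\mapsto T_t(x)$ is smooth for each $x\in K$. Let $X$ be a $K$-valued random vector with $\mathbb{E}\|X\|_2<\infty$, and suppose that $$\mathbb{E}\,\sup_{t}\Big\|\frac{d}{dt}T_t(X)\Big\|_2<\infty .$$ Let $s>0$. Then for any convex function $\phi:[0,\infty)\to\mathbb{R}$ satisfying $\phi(0)=0$, the quantity $$\int_{\mathbb{R}^n}\phi\big(f_{T_t(X)+\sqrt{s}Z}(x)\big)\,dx$$ is monotonically increasing (i.e. non-decreasing) in $t\in[0,1]$.
   Context: $\|\cdot\|_2$ is the Euclidean norm. A contraction means a $1$-Lipschitz map. A contraction $T:K\to\mathbb{R}^n$ is a continuous contraction if each $x\in K$ can be joined to $T(x)$ by a curve $c_x:[0,1]\to\mathbb{R}^n$, $c_x(0)=x$, $c_x(1)=T(x)$, such that for all $x,y\in K$ the function $t\mapsto\|c_x(t)-c_y(t)\|_2$ is monotonically decreasing (non-increasing). In this case $T_t:x\mapsto c_x(t)$, $t\in[0,1]$, is called a continuously contracting family of maps and $t\mapsto T_t(x)$ is the trajectory of $x$. $Z$ is a standard Gaussian random vector in $\mathbb{R}^n$ (density $(2\pi)^{-n/2}e^{-\|x\|_2^2/2}$), independent of $X$; $f_W$ denotes the density of a random vector $W$ with respect to Lebesgue measure. Integrals may take values in the extended reals. *)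

(* Defs.v *)
From HB Require Import structures.
From mathcomp Require Import all_boot all_order all_algebra.
From mathcomp Require Import all_classical all_reals all_analysis.

Set Implicit Arguments.
Unset Strict Implicit.
Unset Printing Implicit Defensive.

Import Order.TTheory GRing.Theory Num.Theory.
Import numFieldNormedType.Exports.

Local Open Scope classical_set_scope.
Local Open Scope ring_scope.

(* The norm that MathComp-Analysis puts on matrices is the maximum norm (which
   has the same topology), hence a separate Euclidean norm. *)
Definition norm2 (R : realType) (n : nat) (x : 'rV[R]_n) : R :=
  Num.sqrt (\sum_(i < n) x ord0 i ^+ 2).

(* Product sigma-algebra of 'rV[R]_n, generated by the coordinate maps; it is
   the Borel sigma-algebra of R^n. *)
Definition measure_rV_display : measure_display. Proof. exact. Qed.

Section measurable_rV.
Variables (R : realType) (n : nat).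

Definition rV_measurable : set (set 'rV[R]_n) :=
  g_sigma_preimage (fun (i : 'I_n) (x : 'rV[R]_n) => x ord0 i).

Let rV_set0 : rV_measurable set0.
Proof. exact: sigma_algebra0. Qed.

Let rV_setC A : rV_measurable A -> rV_measurable (~` A).
Proof. exact: sigma_algebraC. Qed.

Let rV_bigcup (F : (set 'rV[R]_n)^nat) : (forall i, rV_measurable (F i)) ->
  rV_measurable (\bigcup_i (F i)).
Proof. exact: sigma_algebra_bigcup. Qed.

HB.instance Definition _ := @isMeasurable.Build measure_rV_display
  'rV[R]_n rV_measurable rV_set0 rV_setC rV_bigcup.

End measurable_rV.

Section measurable_rV_lemmas.
Variable R : realType.

Lemma measurable_coord n (i : 'I_n) :
  measurable_fun [set: 'rV[R]_n] (fun x : 'rV[R]_n => x ord0 i).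
Proof.
move=> _ Y mY; rewrite setTI; apply: sub_sigma_algebra => /=.
rewrite -bigcup_seq/=; exists i => /=; first by rewrite mem_index_enum.
by exists Y => //; rewrite setTI.
Qed.

Lemma measurable_fun_rVP d (T : measurableType d) n (f : T -> 'rV[R]_n) :
  measurable_fun setT f <-> forall i, measurable_fun setT (fun t => f t ord0 i).
Proof.
split=> [mf i|mf].
  exact: (measurableT_comp (@measurable_coord n i) mf).
apply: (@measurability _ _ T 'rV[R]_n setT f
  (\big[setU/set0]_(i < n) preimage_set_system setT
    (fun x : 'rV[R]_n => x ord0 i) measurable)) => //.
move=> _ [B + <-]; rewrite -bigcup_seq/= => -[i _ [C mC <-]].
by rewrite setTI; have := mf i measurableT C mC; rewrite !setTI.
Qed.

Definition consrV n (p : R * 'rV[R]_n) : 'rV[R]_n.+1 := row_mx p.1%:M p.2.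

Lemma consrV0 n p : @consrV n p ord0 ord0 = p.1.
Proof.
rewrite /consrV mxE; case: splitP => [j _|k]; last by [].
by rewrite (ord1 j) mxE eqxx mulr1n.
Qed.

Lemma consrVS n p i : @consrV n p ord0 (lift ord0 i) = p.2 ord0 i.
Proof.
rewrite /consrV mxE; case: splitP => [[[|//] ?] //|k /= [ik]].
by congr (p.2 _ _); apply/val_inj.
Qed.

Lemma measurable_consrV n : measurable_fun setT (@consrV n).
Proof.
apply/measurable_fun_rVP => i.
have [j ->|->] := unliftP ord0 i.
  under eq_fun do rewrite consrVS.
  exact: (measurableT_comp (@measurable_coord n j) measurable_snd).
by under eq_fun do rewrite consrV0; exact: measurable_fst.
Qed.

End measurable_rV_lemmas.

(* Lebesgue measure on R^n: the unit mass on the one-point space R^0, and the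
   image of the product measure on R * R^n under R * R^n = R^(n+1). *)
Fixpoint lebesgue_rV (R : realType) (n : nat) : set 'rV[R]_n -> \bar R :=
  match n with
  | 0%N => \d_(0 : 'rV[R]_0)
  | m.+1 => pushforward
      (product_measure1 (@lebesgue_measure R) (@lebesgue_rV R m)) (@consrV R m)
  end.

Section sigma_finite_measure_ex.
Context d (T : measurableType d) (R : realType).
Context (mu : {measure set T -> \bar R}) (muoo : sigma_finite setT mu).

Let nu : set T -> \bar R := mu.

HB.instance Definition _ := Measure.on nu.

HB.instance Definition _ := Measure_isSigmaFinite.Build _ _ _ nu muoo.

Lemma sigma_finite_measure_ex :
  exists m : {sigma_finite_measure set T -> \bar R},
    mu = m :> (set T -> \bar R).
Proof. by exists nu. Qed.

End sigma_finite_measure_ex.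

Section lebesgue_rV_measure.
Variable R : realType.
Local Open Scope ereal_scope.

Let lebesgue_rV_ex n :
  exists m : {sigma_finite_measure set 'rV[R]_n -> \bar R}, @lebesgue_rV R n = m.
Proof.
elim: n => [|n [m IH]]; first by exists \d_(0%R : 'rV[R]_0).
rewrite /= IH; set mu := pushforward _ _.
have muoo : sigma_finite setT mu.
  have /sigma_finiteP[F [TF ndF Foo]] := sigma_finiteT (@lebesgue_measure R).
  have /sigma_finiteP[G [TG ndG Goo]] := sigma_finiteT m.
  exists (fun k => [set x : 'rV[R]_n.+1 |
      F k (x ord0 ord0) /\ G k (\row_i x ord0 (lift ord0 i))%R]).
    apply/seteqP; split => // x _.
    have [k1 _ Fk1] : (\bigcup_k F k) (x ord0 ord0) by rewrite -TF.
    have [k2 _ Gk2] : (\bigcup_k G k) (\row_i x ord0 (lift ord0 i))%R.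
      by rewrite -TG.
    exists (maxn k1 k2) => //; split.
      by move: Fk1; exact/subsetPset/ndF/leq_maxl.
    by move: Gk2; exact/subsetPset/ndG/leq_maxr.
  move=> k; have [mFk Fkoo] := Foo k; have [mGk Gkoo] := Goo k; split.
    apply: measurableI; rewrite -[X in measurable X]setTI.
      exact: (@measurable_coord R n.+1 ord0).
    have : measurable_fun setT (fun x : 'rV[R]_n.+1 =>
      (\row_i x ord0 (lift ord0 i))%R : 'rV[R]_n).
      apply/measurable_fun_rVP => i /=; under eq_fun do rewrite mxE.
      exact: measurable_coord.
    exact.
  rewrite /mu /pushforward (_ : _ @^-1` _ = F k `*` G k).
    by rewrite product_measure1E// lte_mul_pinfty// ge0_fin_numE.
  apply/seteqP; split => -[x y] /=; rewrite consrV0 (_ : (\row_i _)%R = y)//;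
    by apply/rowP => i; rewrite mxE consrVS.
pose mu' :
  {measure set 'rV[R]_n.+1 -> \bar R} :=
  pushforward (product_measure1 (@lebesgue_measure R) m) (@consrV R n).
exact: (sigma_finite_measure_ex (mu := mu' (@measurable_consrV R n)) muoo).
Qed.

Let lebesgue_rV0 n : @lebesgue_rV R n set0 = 0.
Proof. by have [m ->] := lebesgue_rV_ex n. Qed.

Let lebesgue_rV_ge0 n A : 0 <= @lebesgue_rV R n A.
Proof. by have [m ->] := lebesgue_rV_ex n. Qed.

Let lebesgue_rV_sigma_additive n : semi_sigma_additive (@lebesgue_rV R n).
Proof.
by have [m ->] := lebesgue_rV_ex n; exact: measure_semi_sigma_additive.
Qed.

HB.instance Definition _ n := isMeasure.Build _ _ _ (@lebesgue_rV R n)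
  (lebesgue_rV0 n) (@lebesgue_rV_ge0 n) (@lebesgue_rV_sigma_additive n).

Let lebesgue_rV_sigma_finite n : sigma_finite setT (@lebesgue_rV R n).
Proof. by have [m ->] := lebesgue_rV_ex n; exact: sigma_finiteT. Qed.

HB.instance Definition _ n := Measure_isSigmaFinite.Build _ _ _
  (@lebesgue_rV R n) (lebesgue_rV_sigma_finite n).

Lemma lebesgue_rV_box n (A : 'I_n -> set R) : (forall i, measurable (A i)) ->
  lebesgue_rV [set x : 'rV[R]_n | forall i, A i (x ord0 i)] =
  \prod_(i < n) lebesgue_measure (A i).
Proof.
elim: n A => [|n IH] A mA.
  by rewrite big_ord0 /= diracE mem_set// => -[].
have mA' : measurable [set x : 'rV[R]_n | forall i, A (lift ord0 i) (x ord0 i)].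
  rewrite (_ : mkset _ = \bigcap_(i in [set: 'I_n])
      ((fun x : 'rV[R]_n => x ord0 i) @^-1` A (lift ord0 i))).
    apply: fin_bigcap_measurable => // i _; rewrite -[X in measurable X]setTI.
    exact: measurable_coord.
  by apply/seteqP; split => [x Ax i _|x Ax i]; exact: Ax.
rewrite big_ord_recl -IH// -product_measure1E//; last exact: (mA ord0).
rewrite /= /pushforward; congr (product_measure1 _ _ _).
apply/seteqP; split => -[x y] /=.
  move=> Axy; split; first by have := Axy ord0; rewrite consrV0.
  by move=> i; have := Axy (lift ord0 i); rewrite consrVS.
move=> [Ax Ay] i; have [j ->|->] := unliftP ord0 i.
  by rewrite consrVS; exact: Ay.
by rewrite consrV0.
Qed.

End lebesgue_rV_measure.

(* Differentiation along a set A of times: derivatives at the endpoints of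
   [0, 1] are one-sided. *)
Definition diff_quot (R : realType) (V : normedModType R) (c : R -> V) (t : R)
  : R -> V := fun h => h^-1 *: (c (h + t) - c t).

Definition derivable_in (R : realType) (V : normedModType R) (A : set R)
    (c : R -> V) (t : R) : Prop :=
  cvg (diff_quot c t @ within [set h | A (h + t)] 0^').

Definition derive_in (R : realType) (V : normedModType R) (A : set R)
    (c : R -> V) (t : R) : V :=
  lim (diff_quot c t @ within [set h | A (h + t)] 0^').

Definition smooth_in (R : realType) (V : normedModType R) (A : set R)
    (c : R -> V) : Prop :=
  forall (k : nat) (t : R), A t -> derivable_in A (iter k (derive_in A) c) t.

(* T t x is only meaningful for t in [0, 1] and x in K. *)
Definition continuously_contracting (R : realType) (n : nat)
    (K : set 'rV[R]_n) (T : R -> 'rV[R]_n -> 'rV[R]_n) : Prop :=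
  [/\ forall x, K x -> T 0 x = x,
      forall x, K x -> {within `[0, 1], continuous (fun t => T t x)} &
      forall x y, K x -> K y -> forall t u, 0 <= t -> t <= u -> u <= 1 ->
        norm2 (T u x - T u y) <= norm2 (T t x - T t y)].

Definition is_density (d : measure_display) (Omega : measurableType d)
    (R : realType) (P : probability Omega R) (n : nat)
    (W : Omega -> 'rV[R]_n) (f : 'rV[R]_n -> R) : Prop :=
  [/\ measurable_fun setT f, forall x, 0 <= f x &
      forall A : set 'rV[R]_n, measurable A ->
        P (W @^-1` A) = (\int[@lebesgue_rV R n]_(x in A) (f x)%:E)%E].

Definition gauss_density (R : realType) (n : nat) (x : 'rV[R]_n) : R :=
  (2 * pi) `^ (- (n%:R / 2)) * expR (- (norm2 x ^+ 2 / 2)).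

Definition independent_rv (d : measure_display) (Omega : measurableType d)
    (R : realType) (P : probability Omega R) (d1 d2 : measure_display)
    (T1 : measurableType d1) (T2 : measurableType d2)
    (X : Omega -> T1) (Y : Omega -> T2) : Prop :=
  forall (A : set T1) (B : set T2), measurable A -> measurable B ->
    P (X @^-1` A `&` Y @^-1` B) = (P (X @^-1` A) * P (Y @^-1` B))%E.

(* Main.v *)
Require Import Defs.
From HB Require Import structures.
From mathcomp Require Import all_boot all_order all_algebra.
From mathcomp Require Import all_classical all_reals all_analysis.
From mathcomp Require Import measurable_realfun ring lra.
Import Order.TTheory GRing.Theory Num.Theory.
Import numFieldNormedType.Exports.
Local Open Scope classical_set_scope.
Local Open Scope ring_scope.

(** Write f_t for the density of T_t(X) + sqrt(s) Z.

    Suppose first that X has finitely many values x_i, with probabilities p_i.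
    Put y_i = T_t(x_i), v_i = (d/dt) y_i, and e_i for the Gaussian density
    centered at y_i. Then f = sum_i p_i e_i solves the continuity equation
    (d/dt) f = - div w for the momentum field w = sum_i p_i e_i v_i. For a smooth
    profile q that is nondecreasing on the nonnegative reals and vanishes at 0,

      (d/dt) (f q(f)) + div (q(f) w) = q'(f) (grad f . w - f div w),

    and a computation gives ([sum_dissipation_ge0])

      grad f . w - f div w
        = - (2 s)^-1 sum_ij p_i p_j e_i e_j (y_i - y_j) . (v_i - v_j),

    which is nonnegative because the mutual distances of the y_i do not
    increase. The divergence has integral 0 by translation invariance of the
    Lebesgue measure, so the integral of f q(f) is nondecreasing in t
    ([profile_integral_nondecreasing]). The convexity of r q(r) is not
    used, only the monotonicity of q.

    A general X is the limit of random vectors with finitely many values in K.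
    As T_t is a contraction, the corresponding densities converge pointwise to
    f_t, under an integrable bound, which extends the result to X for the
    profiles q(r) = 1 - 1 / (1 + (r / b)^(2 m)) ([smoothed_profile_le]).
    Letting m tend to infinity gives indicator functions of rays. If phi is
    convex with phi(0) = 0, and M bounds all the f_t, then
    phi(r) = c r - r k(r) on [0, M], with c = phi(M) / M and k nonnegative and
    nonincreasing; the layer-cake formula writes the integral of f k(f) in terms
    of rays, and the integral of c f is c at all times ([convex_integral_le]). *)

Set Implicit Arguments.
Unset Strict Implicit.
Unset Printing Implicit Defensive.

(** * Affine changes of variables *)

(** Change of variables for a map that multiplies the measure by a constant. *)
Lemma ge0_integral_quasi_invariant d (T : measurableType d) (R : realType)
    (mu : {measure set T -> \bar R}) (h : T -> T) (k : {nonneg R})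
    (f : T -> \bar R) :
  measurable_fun setT h ->
  (forall A, measurable A -> mu (h @^-1` A) = (k%:num%:E * mu A)%E) ->
  measurable_fun setT f -> (forall x, 0 <= f x)%E ->
  (\int[mu]_x f (h x) = k%:num%:E * \int[mu]_x f x)%E.
Proof.
move=> mh hk mf f0.
have := ge0_integral_pushforward mh mu measurableT mf (fun x _ => f0 x).
rewrite preimage_setT => <-.
rewrite -ge0_integral_mscale//; apply: eq_measure_integral => A mA _.
exact: hk.
Qed.

Section affine.
Variable R : realType.
Implicit Types (c : R) (n : nat).

Let aff1 c y (r : measurableTypeR R) : measurableTypeR R := c * r + y.

Let measurable_aff1 c y : measurable_fun setT (aff1 c y).
Proof. by apply: measurable_funD => //; apply: measurable_funM. Qed.

Lemma lebesgue_measure_affine c y (A : set R) : 0 < c -> measurable A ->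
  lebesgue_measure ((fun r => c * r + y) @^-1` A) =
  ((c^-1)%:E * lebesgue_measure A)%E.
Proof.
move=> c0 mA.
pose pf : {measure set (measurableTypeR R) -> \bar R} :=
  pushforward (@lebesgue_measure R) (aff1 c y).
pose mu' : {measure set (measurableTypeR R) -> \bar R} :=
  mscale (NngNum (ltW c0)) (pf (measurable_aff1 _ _)).
have := @lebesgue_measure_unique R mu' _ A mA.
rewrite /mu' /mscale/= /pushforward => ->.
  by rewrite muleA -EFinM mulVf ?gt_eqF// mul1e.
move=> _ [[a b] _ <-].
rewrite -[RHS]/(c%:E * lebesgue_measure (aff1 c y @^-1` `]a, b]))%E.
rewrite (_ : _ @^-1` _ = `](a - y) / c, (b - y) / c]%classic); last first.
  apply/seteqP; split => r /=; rewrite !in_itv/= ltr_pdivrMr// ler_pdivlMr//;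
    by rewrite ltrBlDr lerBrDr [r * c]mulrC.
rewrite !lebesgue_measure_itv/= !lte_fin ltr_pM2r ?invr_gt0// ltrD2r.
case: ifPn => _; last by rewrite mule0.
rewrite -!EFinD -EFinM; congr EFin.
by field; rewrite gt_eqF.
Qed.

Lemma ge0_integral_affine c y (f : R -> \bar R) : 0 < c ->
  measurable_fun [set: measurableTypeR R] f -> (forall r, 0 <= f r)%E ->
  (\int[@lebesgue_measure R]_r f (c * r + y)%R =
    (c^-1)%:E * \int[@lebesgue_measure R]_r f r)%E.
Proof.
move=> c0 mf f0; have ci0 : 0 <= c^-1 by rewrite invr_ge0 ltW.
apply: (@ge0_integral_quasi_invariant _ (measurableTypeR R) R
  (@lebesgue_measure R) (aff1 c y) (NngNum ci0) f) => //.
by move=> A mA; exact: lebesgue_measure_affine.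
Qed.

Lemma measurable_affine_rV n c (y : 'rV[R]_n) :
  measurable_fun setT (fun x : 'rV[R]_n => c *: x + y).
Proof.
apply/measurable_fun_rVP => i; under eq_fun do rewrite !mxE.
by apply: measurable_funD => //; apply: measurable_funM => //; exact: measurable_coord.
Qed.

(** By induction on the dimension, slicing along the first coordinate. *)
Lemma lebesgue_rV_affine n c (y : 'rV[R]_n) (A : set 'rV[R]_n) :
  0 < c -> measurable A ->
  lebesgue_rV ((fun x => c *: x + y) @^-1` A) =
  ((c^-1 ^+ n)%:E * lebesgue_rV A)%E.
Proof.
move=> c0; elim: n y A => [|n IH] y A mA.
  rewrite expr0 mul1e /=; congr (\d_ _ _).
  by apply/seteqP; split => x /=; rewrite [_ + _](_ : _ = x)//; apply/rowP; case.
have mB (B : set 'rV[R]_n.+1) : measurable B ->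
    measurable ((@consrV R n) @^-1` B).
  by move=> mB; rewrite -[X in measurable X]setTI; exact: (@measurable_consrV R n measurableT).
have mA' : measurable ((fun x : 'rV[R]_n.+1 => c *: x + y) @^-1` A).
  by rewrite -[X in measurable X]setTI; exact: (@measurable_affine_rV _ c y measurableT).
pose y0 := y ord0 ord0; pose y1 : 'rV[R]_n := \row_i y ord0 (lift ord0 i).
have consE r x : c *: consrV (r, x) + y = consrV (c * r + y0, c *: x + y1).
  have E m (u v : 'rV[R]_m) j : (c *: u + v) ord0 j = c * u ord0 j + v ord0 j.
    by rewrite !mxE.
  apply/rowP => i; rewrite E; have [j ->|->] := unliftP ord0 i.
    by rewrite !consrVS/= E /y1 mxE.
  by rewrite !consrV0.
rewrite /= /pushforward /product_measure1.
transitivity (\int[@lebesgue_measure R]_r ((c^-1 ^+ n)%:E *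
   (@lebesgue_rV R n \o xsection ((@consrV R n) @^-1` A)) (c * r + y0)%R))%E.
  apply: eq_integral => r _ /=; rewrite -(IH y1); last first.
    by apply: measurable_xsection; exact: mB.
  congr (lebesgue_rV _); apply/seteqP; split => x /=;
    by rewrite /xsection/= !inE/= consE.
have mF : measurable_fun [set: measurableTypeR R]
    (@lebesgue_rV R n \o xsection ((@consrV R n) @^-1` A)).
  by apply: measurable_fun_xsection; exact: mB.
rewrite ge0_integralZl//; last first.
- by rewrite lee_fin exprn_ge0// invr_ge0 ltW.
- exact: (measurableT_comp mF (measurable_aff1 c y0)).
by rewrite ge0_integral_affine// muleA -EFinM -exprSr.
Qed.

Lemma ge0_integral_rV_affine n c (y : 'rV[R]_n) (f : 'rV[R]_n -> \bar R) :
  0 < c -> measurable_fun setT f -> (forall x, 0 <= f x)%E ->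
  (\int[@lebesgue_rV R n]_x f (c *: x + y)%R =
    (c^-1 ^+ n)%:E * \int[@lebesgue_rV R n]_x f x)%E.
Proof.
move=> c0 mf f0; have ci0 : 0 <= c^-1 ^+ n by rewrite exprn_ge0// invr_ge0 ltW.
apply: (@ge0_integral_quasi_invariant _ _ R (@lebesgue_rV R n)
  (fun x => c *: x + y) (NngNum ci0) f) => //.
- exact: measurable_affine_rV.
- by move=> A mA; exact: lebesgue_rV_affine.
Qed.

End affine.

(** * The Gaussian kernel *)

Section gauss_kernel.
Variables (R : realType).
Implicit Types (n : nat) (g : R).

(** The squared Euclidean norm; unlike [norm2] it is polynomial in the
    coordinates. *)
Definition sqnorm n (v : 'rV[R]_n) : R := \sum_(i < n) v ord0 i ^+ 2.

(** The unnormalized centered Gaussian kernel exp(-g |v|^2), of precision g. *)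
Definition gker n g (v : 'rV[R]_n) : R := expR (- (g * sqnorm v)).

Lemma sqnorm_ge0 n (v : 'rV[R]_n) : 0 <= sqnorm v.
Proof. by apply: sumr_ge0 => i _; exact: sqr_ge0. Qed.

Lemma norm2K n (v : 'rV[R]_n) : norm2 v ^+ 2 = sqnorm v.
Proof. by rewrite /norm2 sqr_sqrtr// sqnorm_ge0. Qed.

Lemma sqr_coord_le_sqnorm n (v : 'rV[R]_n) i : v ord0 i ^+ 2 <= sqnorm v.
Proof.
rewrite /sqnorm (bigD1 i)//= lerDl.
by apply: sumr_ge0 => j _; exact: sqr_ge0.
Qed.

Lemma sqnormD_le n (u v : 'rV[R]_n) : sqnorm (u + v) <= 2 * sqnorm u + 2 * sqnorm v.
Proof.
rewrite /sqnorm !mulr_sumr -big_split/=; apply: ler_sum => i _; rewrite mxE.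
have := sqr_ge0 (u ord0 i - v ord0 i); nra.
Qed.

Lemma sqnormN n (v : 'rV[R]_n) : sqnorm (- v) = sqnorm v.
Proof. by apply: eq_bigr => i _; rewrite mxE sqrrN. Qed.

Lemma gker_ge0 n g (v : 'rV[R]_n) : 0 <= gker g v.
Proof. exact: expR_ge0. Qed.

Lemma gker_le1 n g (v : 'rV[R]_n) : 0 <= g -> gker g v <= 1.
Proof.
by move=> g0; rewrite /gker -expR0 ler_expR oppr_le0 mulr_ge0// sqnorm_ge0.
Qed.

(** Moving the center by a bounded amount costs a constant factor and half of
    the precision; every domination argument below rests on this bound. *)
Lemma gker_shift_le n g (u v : 'rV[R]_n) : 0 <= g ->
  gker g u <= expR (g * sqnorm (v - u)) * gker (g / 2) v.
Proof.
move=> g0; rewrite /gker -expRD ler_expR.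
have := sqnormD_le u (v - u); rewrite addrC subrK; nra.
Qed.

Lemma coord_gker_le n g (v : 'rV[R]_n) i : 0 < g ->
  `|v ord0 i| * gker g v <= (1 + g^-1) / 2.
Proof.
move=> g0; set z := v ord0 i.
have z1 : `|z| <= (1 + z ^+ 2) / 2.
  have := sqr_ge0 (`|z| - 1); rewrite sqrrB real_normK ?num_real//; lra.
have gz : g * z ^+ 2 <= expR (g * z ^+ 2).
  by apply: le_trans (expR_ge1Dx _); rewrite lerDr.
have e1 : gker g v <= expR (- (g * z ^+ 2)).
  by rewrite ler_expR lerN2 ler_pM2l// sqr_coord_le_sqnorm.
have e2 : expR (- (g * z ^+ 2)) <= 1.
  by rewrite -expR0 ler_expR oppr_le0 mulr_ge0 ?sqr_ge0// ltW.
have e3 : z ^+ 2 * expR (- (g * z ^+ 2)) <= g^-1.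
  by rewrite expRN ler_pdivrMr ?expR_gt0// ler_pdivlMl.
have e0 := expR_ge0 (- (g * z ^+ 2)).
have h1 := ler_pM (normr_ge0 z) (gker_ge0 g v) z1 e1.
apply: le_trans h1 _; nra.
Qed.

Lemma measurable_sqnorm n : measurable_fun setT (@sqnorm n).
Proof.
apply: measurable_sum => i; apply: measurable_funX; exact: measurable_coord.
Qed.

Lemma measurable_gker n g : measurable_fun setT (@gker n g).
Proof.
apply: measurableT_comp => //; apply: measurableT_comp => //.
by apply: measurable_funM => //; exact: measurable_sqnorm.
Qed.

Lemma measurable_funB_rV d (T : measurableType d) n (f h : T -> 'rV[R]_n) :
  measurable_fun setT f -> measurable_fun setT h ->
  measurable_fun setT (fun x => f x - h x).
Proof.
move=> /measurable_fun_rVP mf /measurable_fun_rVP mh.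
by apply/measurable_fun_rVP => i; under eq_fun do rewrite !mxE; exact: measurable_funB.
Qed.

Lemma measurable_gkerB d (T : measurableType d) n g (f h : T -> 'rV[R]_n) :
  measurable_fun setT f -> measurable_fun setT h ->
  measurable_fun setT (fun x => gker g (f x - h x)).
Proof.
move=> mf mh; apply: (measurableT_comp (@measurable_gker n g)).
exact: measurable_funB_rV.
Qed.

(** Normalization of the Gaussian: the kernel is a product over the
    coordinates, so the integral factors one coordinate at a time. *)
Lemma integral_gker1 n :
  (\int[@lebesgue_rV R n]_x (gker 1 x)%:E = (Num.sqrt pi ^+ n)%:E)%E.
Proof.
elim: n => [|n IH].
  rewrite expr0 integral_dirac//; last by apply/measurable_EFinP; exact: measurable_gker.
  by rewrite diracT mul1e /gker /sqnorm big_ord0 mulr0 oppr0 expR0.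
have mg : measurable_fun setT (fun x : 'rV[R]_n.+1 => (gker 1 x)%:E).
  by apply/measurable_EFinP; exact: measurable_gker.
have mc : measurable_fun [set: measurableTypeR R * 'rV[R]_n] (@consrV R n).
  exact: measurable_consrV.
have := ge0_integral_pushforward mc
  [the measure _ _ of product_measure1 (@lebesgue_measure R) (@lebesgue_rV R n)]
  measurableT mg.
rewrite preimage_setT => E.
have -> : (\int[@lebesgue_rV R n.+1]_x (gker 1 x)%:E =
  \int[(@lebesgue_measure R \x @lebesgue_rV R n)%E]_p (gker 1 (@consrV R n p))%:E)%E.
  rewrite -[RHS]E; last by move=> y _; rewrite lee_fin gker_ge0.
  by apply: eq_measure_integral.
rewrite fubini_tonelli1//=; last by move=> p; rewrite lee_fin gker_ge0.
  under eq_integral => r _.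
    rewrite /fubini_F.
    under eq_integral => x _.
      rewrite (_ : gker 1 (consrV (r, x)) = gauss_fun r * gker 1 x); last first.
        rewrite /gker /gauss_fun -expRD !mul1r -opprD /sqnorm big_ord_recl consrV0.
        by under eq_bigr do rewrite consrVS.
      rewrite EFinM.
      over.
    rewrite ge0_integralZl//; last 3 first.
    - by apply/measurable_EFinP; exact: measurable_gker.
    - by move=> x _; rewrite lee_fin gker_ge0.
    - by rewrite lee_fin gauss_fun_ge0.
    rewrite IH muleC.
    over.
  rewrite ge0_integralZl//; last 2 first.
  - have : measurable_fun setT (EFin \o @gauss_fun R); last by [].
    by apply/measurable_EFinP; exact: measurable_gauss_fun.
  - by move=> x _; rewrite lee_fin gauss_fun_ge0.
  by rewrite integralT_gauss -EFinM -exprSr.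
exact: (measurableT_comp mg mc).
Qed.

Lemma integral_gker n g (y : 'rV[R]_n) : 0 < g ->
  (\int[@lebesgue_rV R n]_x (gker g (x - y))%:E =
     ((Num.sqrt pi / Num.sqrt g) ^+ n)%:E)%E.
Proof.
move=> g0; have sg0 : 0 < Num.sqrt g by rewrite sqrtr_gt0.
transitivity (\int[@lebesgue_rV R n]_x
   (fun x => (gker 1 x)%:E) (Num.sqrt g *: x + (- (Num.sqrt g *: y)))%R)%E.
  apply: eq_integral => x _; congr EFin; congr expR; congr (- _).
  rewrite mul1r -scalerBr /sqnorm mulr_sumr; apply: eq_bigr => i _.
  by rewrite [in RHS]mxE exprMn sqr_sqrtr// ltW.
rewrite (@ge0_integral_rV_affine _ _ _ _ (fun x => (gker 1 x)%:E))//; last 2 first.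
- by apply/measurable_EFinP; exact: measurable_gker.
- by move=> x; rewrite lee_fin gker_ge0.
by rewrite integral_gker1 -EFinM -exprMn mulrC.
Qed.

Lemma integrable_gker n g (y : 'rV[R]_n) : 0 < g ->
  (@lebesgue_rV R n).-integrable setT (fun x => (gker g (x - y))%:E).
Proof.
move=> g0; apply/integrableP; split.
  by apply/measurable_EFinP/measurable_gkerB.
under eq_integral do rewrite gee0_abs ?lee_fin ?gker_ge0//.
by rewrite integral_gker// ltry.
Qed.

End gauss_kernel.

(** * Gaussian mixtures and their derivatives *)

Lemma is_derive_bigsum (R : realType) (I : Type) (r : seq I)
    (F : I -> R -> R) (dF : I -> R) (t : R) :
  (forall i, is_derive t 1 (F i) (dF i)) ->
  is_derive t 1 (fun h => \sum_(i <- r) F i h) (\sum_(i <- r) dF i).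
Proof.
move=> dFi; elim: r => [|i r IH].
  by under eq_fun do rewrite big_nil; rewrite big_nil; exact: is_derive_cst.
under eq_fun do rewrite big_cons; rewrite big_cons.
exact: (@is_deriveD _ _ _ (F i) (fun h => \sum_(i <- r) F i h)).
Qed.

Lemma is_derive_sqnorm (R : realType) n (z : R -> 'rV[R]_n) (dz : 'rV[R]_n) (t : R) :
  (forall k, is_derive t 1 (fun h => z h ord0 k) (dz ord0 k)) ->
  is_derive t 1 (fun h => sqnorm (z h)) (2 * \sum_(k < n) z t ord0 k * dz ord0 k).
Proof.
move=> dzk; rewrite mulr_sumr; apply: is_derive_bigsum => k.
have := @is_deriveX _ _ (fun h => z h ord0 k) 2 t 1 _ (dzk k).
rewrite (_ : (fun h => z h ord0 k) ^+ 2 = (fun h => z h ord0 k ^+ 2)); last first.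
  by apply/funext => h; rewrite exprfctE.
by move/is_derive_eq; apply; rewrite expr1 /GRing.scale/= mulrA.
Qed.

Lemma is_derive_gker (R : realType) n (g : R) (z : R -> 'rV[R]_n) (dz : 'rV[R]_n) (t : R) :
  (forall k, is_derive t 1 (fun h => z h ord0 k) (dz ord0 k)) ->
  is_derive t 1 (fun h => gker g (z h))
    (- (2 * g * \sum_(k < n) z t ord0 k * dz ord0 k) * gker g (z t)).
Proof.
move=> dzk; have ds := is_derive_sqnorm dzk.
have d1 : is_derive t 1 (fun h => - (g * sqnorm (z h)))
    (- (2 * g * \sum_(k < n) z t ord0 k * dz ord0 k)).
  have := @is_deriveZ _ _ _ (fun h => sqnorm (z h)) (- g) t 1 _ ds.
  rewrite (_ : - g \*: _ = fun h => - (g * sqnorm (z h))); last first.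
    by apply/funext => h; exact: mulNr.
  by move/is_derive_eq; apply; rewrite /GRing.scale/=; ring.
have := @is_derive1_comp R expR (fun h => - (g * sqnorm (z h))) t _ _
  (is_derive_expR _) d1.
by move/is_derive_eq; apply; rewrite mulrC.
Qed.

(** The algebraic heart of the argument. For masses [a i] at the points [y i]
    moving with the velocities [v i], this is grad f . w - f div w, where f is
    the Gaussian mixture and w its momentum field; symmetrizing in i and j turns
    it into - g sum_ij a_i a_j (y_i - y_j) . (v_i - v_j). *)
Lemma sum_dissipation_ge0 (R : realType) (I : finType) n (a : I -> R)
    (x : 'rV[R]_n) (y v : I -> 'rV[R]_n) (g : R) :
  0 <= g -> (forall i, 0 <= a i) ->
  (forall i j, \sum_(k < n) (y i - y j) ord0 k * (v i - v j) ord0 k <= 0) ->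
  0 <= \sum_(k < n)
    ((\sum_i a i * - (2 * g * (x - y i) ord0 k)) * (\sum_i a i * v i ord0 k) -
     (\sum_i a i) * (\sum_i a i * v i ord0 k * - (2 * g * (x - y i) ord0 k))).
Proof.
move=> g0 a0 yv.
pose s i j k := a i * a j * ((y i - y j) ord0 k * v j ord0 k).
have -> : \sum_(k < n)
    ((\sum_i a i * - (2 * g * (x - y i) ord0 k)) * (\sum_i a i * v i ord0 k) -
     (\sum_i a i) * (\sum_i a i * v i ord0 k * - (2 * g * (x - y i) ord0 k))) =
  2 * g * \sum_k \sum_i \sum_j s i j k.
  rewrite mulr_sumr; apply: eq_bigr => k _.
  rewrite !big_distrlr/= -sumrB mulr_sumr; apply: eq_bigr => i _.
  rewrite -sumrB mulr_sumr; apply: eq_bigr => j _.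
  by rewrite /s !mxE; ring.
rewrite mulr_ge0 ?mulr_ge0//.
have e : \sum_k \sum_i \sum_j s i j k = \sum_k \sum_i \sum_j s j i k.
  by apply: eq_bigr => k _; rewrite exchange_big.
rewrite -(@pmulr_rge0 _ 2)// mulr_natl mulr2n [X in _ + X]e.
rewrite -big_split/=; under eq_bigr do rewrite -big_split/=.
under eq_bigr => k _ do under eq_bigr => i _ do rewrite -big_split/=.
rewrite exchange_big/= sumr_ge0// => i _.
rewrite exchange_big/= sumr_ge0// => j _.
rewrite (_ : \sum_k _ = - (a i * a j) *
  \sum_(k < n) (y i - y j) ord0 k * (v i - v j) ord0 k).
  by rewrite mulNr oppr_ge0 mulr_ge0_le0// mulr_ge0.
rewrite mulr_sumr; apply: eq_bigr => k _.
by rewrite /s !mxE; ring.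
Qed.

Section mixture.
Variables (R : realType) (n : nat) (I : finType) (g : R) (p : I -> R).
Hypotheses (g0 : 0 < g) (p0 : forall i, 0 <= p i).
Implicit Types (Y v : I -> 'rV[R]_n) (x : 'rV[R]_n).

(** The Gaussian mixture with the weights [p] and the centers [Y]. *)
Definition mix Y x := \sum_i p i * gker g (x - Y i).

(** The [k]-th component of the momentum field of a mixture whose centers move
    with the velocities [v]. *)
Definition flux Y v (k : 'I_n) x := \sum_i p i * v i ord0 k * gker g (x - Y i).

(** The time derivative of the mixture when its centers have velocities [v]. *)
Definition dmix Y v x :=
  \sum_i p i * (2 * g * (\sum_(k < n) (x - Y i) ord0 k * v i ord0 k) * gker g (x - Y i)).

(** The partial derivatives in space of [mix] and of [flux]: along the [k]-th
    axis for the mixture, and of the [k]-th component along the [k]-th axis for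
    the momentum field. *)
Definition gmix Y (k : 'I_n) x :=
  \sum_i p i * (- (2 * g * (x - Y i) ord0 k) * gker g (x - Y i)).

Definition gflux Y v (k : 'I_n) x :=
  \sum_i p i * v i ord0 k * (- (2 * g * (x - Y i) ord0 k) * gker g (x - Y i)).

Let M := \sum_i p i.

Let M0 : 0 <= M. Proof. exact: sumr_ge0. Qed.

Let C := (1 + g^-1) / 2.

Lemma mix_ge0 Y x : 0 <= mix Y x.
Proof. by apply: sumr_ge0 => i _; rewrite mulr_ge0// gker_ge0. Qed.

Lemma mix_le Y x : mix Y x <= M.
Proof. by apply: ler_sum => i _; rewrite ler_piMr// gker_le1// ltW. Qed.

Lemma flux_le Y v k x B : (forall i, `|v i ord0 k| <= B) -> `|flux Y v k x| <= B * mix Y x.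
Proof.
move=> vB; apply: le_trans (ler_norm_sum _ _ _) _.
rewrite mulr_sumr; apply: ler_sum => i _.
rewrite !normrM (ger0_norm (p0 i)) (ger0_norm (gker_ge0 _ _)) mulrA.
by rewrite ler_wpM2r ?gker_ge0// mulrC ler_wpM2r.
Qed.

Let coordC x k : `|- (2 * g * x ord0 k) * gker g x| <= 2 * g * C.
Proof.
rewrite normrM normrN !normrM (ger0_norm (gker_ge0 _ _)) (@ger0_norm _ 2)//.
by rewrite (gtr0_norm g0) -mulrA ler_wpM2l ?coord_gker_le// mulr_ge0// ltW.
Qed.

Lemma gmix_le Y k x : `|gmix Y k x| <= 2 * g * C * M.
Proof.
apply: le_trans (ler_norm_sum _ _ _) _.
rewrite mulr_sumr; apply: ler_sum => i _.
by rewrite normrM (ger0_norm (p0 i)) mulrC ler_wpM2r// coordC.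
Qed.

Lemma gflux_le Y v k x B : (forall i, `|v i ord0 k| <= B) ->
  `|gflux Y v k x| <= B * (2 * g * C * M).
Proof.
move=> vB; apply: le_trans (ler_norm_sum _ _ _) _.
rewrite mulrA mulr_sumr; apply: ler_sum => i _.
rewrite normrM normrM (ger0_norm (p0 i)) -mulrA mulrC ler_wpM2r//.
by rewrite ler_pM// coordC.
Qed.

(** The continuity equation. *)
Lemma dmixE Y v x : dmix Y v x = - \sum_k gflux Y v k x.
Proof.
rewrite exchange_big/= -sumrN; apply: eq_bigr => i _.
rewrite mulr_sumr mulr_suml mulr_sumr -sumrN; apply: eq_bigr => k _; ring.
Qed.

Lemma is_derive_mix (Y : I -> R -> 'rV[R]_n) v x (t : R) :
  (forall i k, is_derive t 1 (fun h => Y i h ord0 k) (v i ord0 k)) ->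
  is_derive t 1 (fun h => mix (Y^~ h) x) (dmix (Y^~ t) v x).
Proof.
move=> dY; apply: is_derive_bigsum => i.
have d1 k : is_derive t 1 (fun h => (x - Y i h) ord0 k) ((- v i) ord0 k).
  under eq_fun do rewrite !mxE.
  have := @is_deriveB _ _ _ (fun=> x ord0 k) (fun h => Y i h ord0 k) t 1 _ _
    (is_derive_cst _ _ _) (dY i k).
  by move/is_derive_eq; apply; rewrite sub0r mxE.
have := @is_deriveZ _ _ _ _ (p i) _ _ _ (@is_derive_gker _ _ g _ _ _ d1).
move/is_derive_eq; apply; rewrite /GRing.scale/=; congr (_ * (_ * _)).
rewrite -mulrN -sumrN; congr (_ * _); apply: eq_bigr => k _.
by rewrite (_ : (- v i) ord0 k = - v i ord0 k) ?mulrN ?opprK// mxE.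
Qed.

Let is_derive_gker_line (y : 'rV[R]_n) x k (c t : R) :
  is_derive t 1 (fun h => gker g (x + (h - c) *: delta_mx ord0 k - y))
   (- (2 * g * (x + (t - c) *: delta_mx ord0 k - y) ord0 k) *
     gker g (x + (t - c) *: delta_mx ord0 k - y)).
Proof.
pose z (h : R) := x + (h - c) *: (delta_mx ord0 k : 'rV[R]_n) - y.
have d1 l : is_derive t 1 (fun h => z h ord0 l) ((delta_mx ord0 k : 'rV[R]_n) ord0 l).
  rewrite /z; under eq_fun do rewrite !mxE.
  rewrite mxE eqxx/=.
  have -> : (fun h => x ord0 l + (h - c) * (l == k)%:R - y ord0 l) =
            (fun h => (x ord0 l - y ord0 l - c * (l == k)%:R) + h * (l == k)%:R).
    by apply/funext => h; ring.
  have dM := @is_deriveM R R id (cst (l == k)%:R) t 1 _ _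
    (is_derive_id _ _) (is_derive_cst _ _ _).
  have := @is_deriveD _ _ _ (fun=> x ord0 l - y ord0 l - c * (l == k)%:R) _ t 1 _ _
    (is_derive_cst _ _ _) dM.
  by move/is_derive_eq; apply; rewrite /GRing.scale/= mulr0 !add0r mulr1.
have := @is_derive_gker _ _ g z _ _ d1.
move/is_derive_eq; apply; congr (- (_ * _) * _).
have dE l : (delta_mx ord0 k : 'rV[R]_n) ord0 l = (l == k)%:R by rewrite mxE eqxx.
rewrite (bigD1 k)//= dE eqxx mulr1 big1 ?addr0// => l lk.
by rewrite dE (negbTE lk) mulr0.
Qed.

Lemma is_derive_mix_line Y x k (c t : R) :
  is_derive t 1 (fun h => mix Y (x + (h - c) *: delta_mx ord0 k))
    (gmix Y k (x + (t - c) *: delta_mx ord0 k)).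
Proof.
apply: is_derive_bigsum => i.
exact: (@is_deriveZ _ _ _ _ (p i) _ _ _ (is_derive_gker_line _ _ _ _ _)).
Qed.

Lemma is_derive_flux_line Y v x k (c t : R) :
  is_derive t 1 (fun h => flux Y v k (x + (h - c) *: delta_mx ord0 k))
    (gflux Y v k (x + (t - c) *: delta_mx ord0 k)).
Proof.
apply: is_derive_bigsum => i.
exact: (@is_deriveZ _ _ _ _ (p i * v i ord0 k) _ _ _ (is_derive_gker_line _ _ _ _ _)).
Qed.

Lemma measurable_mix d (T : measurableType d) Y (f : T -> 'rV[R]_n) :
  measurable_fun setT f -> measurable_fun setT (fun w => mix Y (f w)).
Proof.
move=> mf; apply: measurable_sum => i; apply: measurable_funM => //.
exact: measurable_gkerB.
Qed.

Lemma measurable_flux d (T : measurableType d) Y v k (f : T -> 'rV[R]_n) :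
  measurable_fun setT f -> measurable_fun setT (fun w => flux Y v k (f w)).
Proof.
move=> mf; apply: measurable_sum => i; apply: measurable_funM => //.
exact: measurable_gkerB.
Qed.

End mixture.

(** * Translation invariance and domination *)

Lemma nonincreasing_is_derive_le0 (R : realType) (f : R -> R) (a b t df : R) :
  (forall x, x \in `]a, b[ -> derivable f x 1) ->
  (forall x y, a < x -> x <= y -> y < b -> f y <= f x) ->
  t \in `]a, b[ -> is_derive t 1 f df -> df <= 0.
Proof.
move=> dfab ninc tab tdf.
apply/ler_addgt0Pr => e e0; rewrite add0r.
(* Subtracting e x makes the function strictly decreasing. *)
pose h x := f x + (- e) * x.
have dmul (x : R) : is_derive x 1 (fun x => (- e) * x) (- e).
  have := @is_deriveZ _ _ _ (@id R) (- e) x 1 _ (is_derive_id _ _).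
  by move/is_derive_eq; apply; rewrite /GRing.scale/= mulr1.
have dh (x dx : R) : is_derive x 1 f dx -> is_derive x 1 h (dx - e).
  by move=> fx; exact: (@is_deriveD _ _ _ f (fun x => (- e) * x)).
have : derive1 h t <= 0.
  apply: (@decr_derive1_le0_itv R h false true a b) => //.
    move=> x; rewrite inE/= => xab; have /dh [] // := @derivableP _ _ _ f x 1 (dfab _ xab).
  move=> x y; rewrite !in_itv/= => /andP[ax xb] /andP[ay yb] yx.
  rewrite /h ler_ltD//; first exact: (ninc y x ay (ltW yx) xb).
  by rewrite ltr_nM2l// oppr_lt0.
by have /dh[_] := tdf; rewrite derive1E => ->; rewrite subr_le0.
Qed.

Section shift.
Variables (R : realType) (n : nat).
Implicit Types (f : 'rV[R]_n -> R) (c : 'rV[R]_n).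

Lemma measurable_shift_rV c : measurable_fun setT (fun x : 'rV[R]_n => x + c).
Proof.
have := @measurable_affine_rV R n 1 c.
by under eq_fun do rewrite scale1r.
Qed.

Lemma ge0_integral_shift_rV (f : 'rV[R]_n -> \bar R) c : measurable_fun setT f ->
  (forall x, 0 <= f x)%E ->
  (\int[@lebesgue_rV R n]_x f (x + c)%R = \int[@lebesgue_rV R n]_x f x)%E.
Proof.
move=> mf f0; have := @ge0_integral_rV_affine R n 1 c f ltr01 mf f0.
rewrite invr1 expr1n mul1e => <-.
by apply: eq_integral => x _; rewrite scale1r.
Qed.

Lemma integral_shift_rV (f : 'rV[R]_n -> \bar R) c : measurable_fun setT f ->
  (\int[@lebesgue_rV R n]_x f (x + c)%R = \int[@lebesgue_rV R n]_x f x)%E.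
Proof.
move=> mf; rewrite integralE [RHS]integralE.
rewrite -(ge0_integral_shift_rV c (measurable_funepos mf))//.
rewrite -(ge0_integral_shift_rV c (measurable_funeneg mf))//.
by congr (_ - _)%E; apply: eq_integral => x _; rewrite ?funeposE ?funenegE.
Qed.

Lemma integrable_shift_rV f c :
  (@lebesgue_rV R n).-integrable setT (EFin \o f) ->
  (@lebesgue_rV R n).-integrable setT (EFin \o (fun x => f (x + c))).
Proof.
move=> /integrableP[mf foo]; apply/integrableP; split.
  exact: (measurableT_comp mf (measurable_shift_rV c)).
have := @ge0_integral_shift_rV (fun x => `|(f x)%:E|)%E c; rewrite /comp => -> //.
by apply: measurableT_comp => //; exact: measurable_abse.
Qed.

Lemma Rintegral_shift_rV f c :
  measurable_fun setT f ->
  \int[@lebesgue_rV R n]_x f (x + c) = \int[@lebesgue_rV R n]_x f x.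
Proof.
move=> mf; rewrite /Rintegral; congr fine.
by apply: (@integral_shift_rV (EFin \o f)); apply/measurable_EFinP.
Qed.

End shift.

Section mixture_domination.
Variables (R : realType) (n : nat) (I : finType) (g : R) (p : I -> R).
Hypotheses (g0 : 0 < g) (p0 : forall i, 0 <= p i).
Implicit Types (Y : I -> 'rV[R]_n) (x c : 'rV[R]_n).

Lemma mix_le_mix_half Y Y' x x' :
  (forall i, sqnorm ((x' - Y' i) - (x - Y i)) <= 1) ->
  mix g p Y x <= expR g * mix (g / 2) p Y' x'.
Proof.
move=> H; rewrite mulr_sumr; apply: ler_sum => i _.
rewrite mulrCA ler_wpM2l//.
apply: le_trans (gker_shift_le _ (x' - Y' i) (ltW g0)) _.
by rewrite ler_wpM2r ?gker_ge0// ler_expR -[leRHS]mulr1 ler_wpM2l// ltW.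
Qed.

Lemma integrable_mix Y :
  (@lebesgue_rV R n).-integrable setT (EFin \o mix g p Y).
Proof.
rewrite (_ : EFin \o _ =
    fun x => (\sum_i (p i)%:E * (gker g (x - Y i))%:E)%E); last first.
  by apply/funext => x; rewrite /= /mix -sumEFin.
apply: integrable_sum => // i _; apply: integrableZl => //.
exact: integrable_gker.
Qed.

Lemma le_mix_integrable Y K (f : 'rV[R]_n -> R) : measurable_fun setT f ->
  (forall x, `|f x| <= K * mix g p Y x) ->
  (@lebesgue_rV R n).-integrable setT (EFin \o f).
Proof.
move=> mf fK.
apply: (@le_integrable _ _ _ _ _ _ _ (fun x => K%:E * (mix g p Y x)%:E)%E) => //.
- exact/measurable_EFinP.
- move=> x _ /=; rewrite lee_fin.
  by apply: le_trans (fK x) _; exact: ler_norm.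
- by apply: integrableZl => //; exact: integrable_mix.
Qed.

End mixture_domination.

(** * Monotonicity for finitely many contracting points *)

Section convergence.
Variables (R : realType) (T : Type) (F : set_system T).
Context {FF : Filter F}.

Lemma cvg_sumr (I : Type) (r : seq I) (f : I -> T -> R) (a : I -> R) :
  (forall i, f i h @[h --> F] --> a i) ->
  \sum_(i <- r) f i h @[h --> F] --> \sum_(i <- r) a i.
Proof.
move=> fa; elim: r => [|i r IH].
  by under eq_fun do rewrite big_nil; rewrite big_nil; exact: cvg_cst.
under eq_fun do rewrite big_cons; rewrite big_cons.
exact: cvgD.
Qed.

Lemma cvg_sqnorm n (z : T -> 'rV[R]_n) (w : 'rV[R]_n) :
  (forall k, z h ord0 k @[h --> F] --> w ord0 k) ->
  sqnorm (z h) @[h --> F] --> sqnorm w.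
Proof.
move=> zw; apply: cvg_sumr => k; rewrite expr2; under eq_fun do rewrite expr2.
exact: cvgM.
Qed.

Lemma cvg_gkerB n g (x : 'rV[R]_n) (z : T -> 'rV[R]_n) (w : 'rV[R]_n) :
  (forall k, z h ord0 k @[h --> F] --> w ord0 k) ->
  gker g (x - z h) @[h --> F] --> gker g (x - w).
Proof.
move=> zw.
have : - (g * sqnorm (x - z h)) @[h --> F] --> - (g * sqnorm (x - w)).
  apply: cvgN; apply: cvgM; first exact: cvg_cst.
  apply: cvg_sqnorm => k; rewrite !mxE; under eq_fun do rewrite !mxE.
  by apply: cvgB => //; exact: cvg_cst.
by apply: continuous_cvg; exact: continuous_expR.
Qed.

End convergence.

Lemma Rintegral_sumr d (T : measurableType d) (R : realType)
    (mu : {measure set T -> \bar R}) (I : Type) (r : seq I) (f : I -> T -> R) :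
  (forall i, mu.-integrable setT (EFin \o f i)) ->
  \int[mu]_x (\sum_(i <- r) f i x) = \sum_(i <- r) \int[mu]_x f i x.
Proof.
move=> fi; elim: r => [|i r IH].
  rewrite big_nil; under eq_Rintegral do rewrite big_nil.
  by rewrite Rintegral_cst// mul0r.
rewrite big_cons -IH -RintegralD//.
  by apply: eq_Rintegral => x _; rewrite big_cons.
rewrite (_ : EFin \o _ = fun x => (\sum_(i <- r) (f i x)%:E)%E).
  by apply: (@integrable_sum _ _ _ mu _ measurableT I r xpredT (fun i => EFin \o f i)).
by apply/funext => x; rewrite /= sumEFin.
Qed.

(** Finitely many centers [y i] move in such a way that their mutual distances
    do not increase on [0, 1]; [v i] is the velocity of [y i]. The profile [q] is
    nondecreasing on the half-line of nonnegative reals, and vanishes at 0 at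
    least linearly. The section shows that the integral of f q(f) is
    nondecreasing in time, f being the mixture. The curves are continuous on the
    whole line, which costs nothing: they can be frozen outside of [0, 1]. *)
Section finite_contraction.
Variables (R : realType) (n : nat) (I : finType) (g : R) (p : I -> R).
Hypotheses (g0 : 0 < g) (p0 : forall i, 0 <= p i).
Variables (q q' : R -> R) (L : R).
Hypothesis dq : forall r : R, is_derive r 1 q (q' r).
Hypothesis q'_bnd : forall r, 0 <= r -> 0 <= q' r <= L.
Hypothesis q_bnd : forall r, 0 <= r -> 0 <= q r <= L * r.
Variables (y v : I -> R -> 'rV[R]_n).
Hypothesis cy : forall i k, continuous (fun h => y i h ord0 k).
Hypothesis dy : forall i k (t : R), 0 < t -> t < 1 ->
  is_derive t 1 (fun h => y i h ord0 k) (v i t ord0 k).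
Hypothesis cv : forall i k (t : R), 0 < t -> t < 1 ->
  {for t, continuous (fun h => v i h ord0 k)}.
Hypothesis contr : forall i j s t, 0 <= s -> s <= t -> t <= 1 ->
  sqnorm (y i t - y j t) <= sqnorm (y i s - y j s).

Local Notation mixt h := (mix g p (y^~ h)).

Let L0 : 0 <= L.
Proof. by have /andP[/le_trans] := q'_bnd (lexx 0); apply. Qed.

Let cq : continuous q.
Proof.
move=> r; apply: differentiable_continuous; apply/derivable1_diffP.
by have [] := dq r.
Qed.

Let mq : measurable_fun setT q.
Proof. exact: continuous_measurable_fun. Qed.

(** The infinitesimal form of the contraction property. *)
Lemma contraction_velocity i j (t : R) : 0 < t -> t < 1 ->
  \sum_(k < n) (y i t - y j t) ord0 k * (v i t - v j t) ord0 k <= 0.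
Proof.
move=> t0 t1.
have dB (s : R) : 0 < s -> s < 1 -> is_derive s 1 (fun h => sqnorm (y i h - y j h))
    (2 * \sum_(k < n) (y i s - y j s) ord0 k * (v i s - v j s) ord0 k).
  move=> s0 s1; apply: (@is_derive_sqnorm R n (fun h => y i h - y j h)) => k.
  under eq_fun do rewrite !mxE.
  have := @is_deriveB _ _ _ (fun h => y i h ord0 k) (fun h => y j h ord0 k) s 1 _ _
    (dy i k s0 s1) (dy j k s0 s1).
  by move/is_derive_eq; apply; rewrite !mxE.
rewrite -(@pmulr_rle0 _ 2)//.
apply: (@nonincreasing_is_derive_le0 R _ 0 1 t _ _ _ _ (dB t t0 t1)).
- by move=> x; rewrite in_itv/= => /andP[x0 x1]; have [] := dB x x0 x1.
- by move=> a b a0 ab b1; apply: contr => //; exact: ltW.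
- by rewrite in_itv/= t0.
Qed.

Let near_close (t : R) :
  \forall h \near t, forall i, sqnorm (y i h - y i t) <= 1.
Proof.
apply: (@filter_forall R I (fun i h => sqnorm (y i h - y i t) <= 1)
  (nbhs t) (nbhs_filter t)) => i.
have : sqnorm (y i h - y i t) @[h --> t] --> sqnorm (y i t - y i t).
  apply: cvg_sqnorm => k; rewrite !mxE; under eq_fun do rewrite !mxE.
  by apply: cvgB; [exact: cy|exact: cvg_cst].
rewrite subrr (_ : sqnorm 0 = 0); last first.
  by rewrite /sqnorm big1// => k _; rewrite mxE expr0n.
by move=> /cvgr_le /(_ 1 ltr01).
Qed.

Let near_bounded (t : R) : 0 < t -> t < 1 ->
  exists B, 0 <= B /\ \forall h \near t, forall i k, `|v i h ord0 k| <= B.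
Proof.
move=> t0 t1.
pose b i k := `|v i t ord0 k| + 1.
exists (\sum_i \sum_k b i k); split.
  by do 2 (apply: sumr_ge0 => ? _); rewrite addr_ge0.
apply: (@filter_forall R I (fun i h => forall k, `|v i h ord0 k| <= _)
  (nbhs t) (nbhs_filter t)) => i.
apply: (@filter_forall R 'I_n (fun k h => `|v i h ord0 k| <= _) (nbhs t) (nbhs_filter t)) => k.
have /cvg_norm/cvgr_le := @cv i k t t0 t1.
move=> /(_ (b i k)); rewrite ltrDl => /(_ ltr01).
apply: filterS => h /le_trans; apply.
rewrite (bigD1 i)//= (bigD1 k)//= -addrA lerDl addr_ge0//.
  by apply: sumr_ge0 => ? _; rewrite addr_ge0.
by do 2 (apply: sumr_ge0 => ? _); rewrite addr_ge0.
Qed.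

Let M := \sum_i p i.

Let integrable_profile h :
  (@lebesgue_rV R n).-integrable setT
    (EFin \o (fun x => mixt h x * q (mixt h x))).
Proof.
apply: (@le_mix_integrable R n I g p g0 (y^~ h) (L * M)).
  apply: measurable_funM; first exact: measurable_mix.
  by apply: measurableT_comp => //; exact: measurable_mix.
move=> x; have f0 := mix_ge0 g p0 (y^~ h) x; have fM := mix_le g0 p0 (y^~ h) x.
have /andP[q0 qL] := q_bnd f0.
rewrite normrM !ger0_norm// mulrC ler_wpM2r// (le_trans qL)//.
by rewrite ler_wpM2l.
Qed.

(** The quantity to be shown monotone, at time [h]. *)
Definition profile_int h := \int[@lebesgue_rV R n]_x (mixt h x * q (mixt h x)).

(** The vector field q(f) w, whose divergence integrates to 0; here w is the
    momentum field of the mixture at time [t]. *)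
Let u t k x := q (mixt t x) * flux g p (y^~ t) (v^~ t) k x.

Let measurable_u t k : measurable_fun setT (u t k).
Proof.
apply: measurable_funM; last exact: measurable_flux.
by apply: measurableT_comp => //; exact: measurable_mix.
Qed.

Let integrable_u t k B : (forall i, `|v i t ord0 k| <= B) ->
  (@lebesgue_rV R n).-integrable setT (EFin \o u t k).
Proof.
move=> vB.
apply: (@le_mix_integrable R n I g p g0 (y^~ t) (L * M * B)); first exact: measurable_u.
move=> x; have f0 := mix_ge0 g p0 (y^~ t) x; have fM := mix_le g0 p0 (y^~ t) x.
have /andP[q0 qL] := q_bnd f0.
rewrite normrM ger0_norm// -mulrA ler_pM//; last exact: flux_le.
by rewrite (le_trans qL)// ler_wpM2l.
Qed.

(** The field [u t] is translated along the axes instead of being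
    differentiated: by translation invariance the integral of [Psi t h] is that
    of f q(f) at time [h], up to a constant. Its derivative at [h = t] adds the
    divergence of [u t] to the time derivative of f q(f), and is nonnegative at
    each point, so that no integration by parts is needed. *)
Let Psi t h x := mixt h x * q (mixt h x) +
  \sum_(k < n) u t k (x + (h - t) *: delta_mx ord0 k).

Let dPsi t h x :=
  (q (mixt h x) + mixt h x * q' (mixt h x)) * dmix g p (y^~ h) (v^~ h) x +
  \sum_(k < n) (fun x' =>
     q' (mixt t x') * gmix g p (y^~ t) k x' * flux g p (y^~ t) (v^~ t) k x' +
     q (mixt t x') * gflux g p (y^~ t) (v^~ t) k x')
       (x + (h - t) *: delta_mx ord0 k).

Let is_derive_Psi (t h : R) x : 0 < h -> h < 1 ->
  is_derive h 1 (fun h => Psi t h x) (dPsi t h x).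
Proof.
move=> h0 h1.
have dm : is_derive h 1 (fun h => mixt h x) (dmix g p (y^~ h) (v^~ h) x).
  by apply: is_derive_mix => i k; exact: dy.
have dqm := @is_derive1_comp R q (fun h => mixt h x) h _ _ (dq _) dm.
have d1 := @is_deriveM R R (fun h => mixt h x) (q \o (fun h => mixt h x)) h 1 _ _ dm dqm.
apply: is_derive_eq.
  apply: (@is_deriveD _ _ _ (fun h => mixt h x * q (mixt h x))
    (fun h => \sum_(k < n) u t k (x + (h - t) *: delta_mx ord0 k)) h 1 _ _ d1).
  apply: is_derive_bigsum => k.
  have dl := @is_derive_mix_line R n I g p (y^~ t) x k t h.
  have dql := @is_derive1_comp R q _ h _ _ (dq _) dl.
  exact: (@is_deriveM R R _ _ h 1 _ _ dql
    (@is_derive_flux_line R n I g p (y^~ t) (v^~ t) x k t h)).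
rewrite /dPsi /GRing.scale/=; congr (_ + _); first by ring.
by apply: eq_bigr => k _; ring.
Qed.

Let dPsi_ge0 (t : R) x : 0 < t -> t < 1 -> 0 <= dPsi t t x.
Proof.
move=> t0 t1.
have f0 := mix_ge0 g p0 (y^~ t) x.
have /andP[q'0 _] := q'_bnd f0.
pose a i := p i * gker g (x - y i t).
have a0 i : 0 <= a i by rewrite mulr_ge0// gker_ge0.
have -> : dPsi t t x = q' (mixt t x) * \sum_(k < n)
    ((\sum_i a i * - (2 * g * (x - y i t) ord0 k)) * (\sum_i a i * v i t ord0 k) -
     (\sum_i a i) * (\sum_i a i * v i t ord0 k * - (2 * g * (x - y i t) ord0 k))).
  rewrite /dPsi dmixE subrr mulrN mulr_sumr -sumrN -big_split/= mulr_sumr.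
  apply: eq_bigr => k _; rewrite scale0r addr0.
  have -> : \sum_i a i * - (2 * g * (x - y i t) ord0 k) = gmix g p (y^~ t) k x.
    by apply: eq_bigr => i _; rewrite /a; ring.
  have -> : \sum_i a i * v i t ord0 k = flux g p (y^~ t) (v^~ t) k x.
    by apply: eq_bigr => i _; rewrite /a; ring.
  have -> : \sum_i a i * v i t ord0 k * - (2 * g * (x - y i t) ord0 k) =
      gflux g p (y^~ t) (v^~ t) k x.
    by apply: eq_bigr => i _; rewrite /a; ring.
  have -> : \sum_i a i = mixt t x by [].
  ring.
rewrite mulr_ge0//; apply: sum_dissipation_ge0 => //; first exact: ltW.
by move=> i j; exact: contraction_velocity.
Qed.

(** A bound of the derivative by an integrable function, uniform for [h] near
    [t]. *)
Let dPsi_bnd (t : R) B : 0 < t -> t < 1 -> 0 <= B ->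
  (forall i k, `|v i t ord0 k| <= B) ->
  exists2 K, 0 <= K & forall h x, 0 < h -> h < 1 -> `|h - t| <= 1 ->
    (forall i k, `|v i h ord0 k| <= B) ->
    (forall i, sqnorm (y i h - y i t) <= 1) ->
    `|dPsi t h x| <= K * mix (g / 2) p (y^~ t) x.
Proof.
move=> t0 t1 B0 vtB.
have M0 : 0 <= M by exact: sumr_ge0.
have [D DE] : exists D, D = 2 * g * ((1 + g^-1) / 2) * M by eexists.
have D0 : 0 <= D.
  by rewrite DE !mulr_ge0// ?ltW// ?addr_gt0// ?invr_gt0//; apply: ltW.
exists (2 * L * (\sum_(k < n) B * D) * expR g + \sum_(k < n) 2 * L * B * D * expR g).
  by rewrite addr_ge0 ?mulr_ge0 ?expR_ge0//; apply: sumr_ge0 => k _;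
    rewrite !mulr_ge0 ?expR_ge0.
move=> h x h0 h1 ht vB yB.
rewrite mulrDl mulr_suml /dPsi.
apply: le_trans (ler_normD _ _) _; apply: lerD.
  have f0 := mix_ge0 g p0 (y^~ h) x.
  have /andP[q0 qL] := q_bnd f0.
  have /andP[q'0 q'L] := q'_bnd f0.
  have fE : mixt h x <= expR g * mix (g / 2) p (y^~ t) x.
    apply: mix_le_mix_half => // i.
    by rewrite (_ : _ - _ = y i h - y i t)//; apply/rowP => k; rewrite !mxE; ring.
  have dB : `|dmix g p (y^~ h) (v^~ h) x| <= \sum_(k < n) B * D.
    rewrite dmixE normrN; apply: le_trans (ler_norm_sum _ _ _) _.
    by apply: ler_sum => k _; rewrite DE; exact: gflux_le.
  have q2 : `|q (mixt h x) + mixt h x * q' (mixt h x)| <=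
      2 * L * (expR g * mix (g / 2) p (y^~ t) x).
    rewrite ger0_norm ?addr_ge0 ?mulr_ge0//.
    apply: (@le_trans _ _ (2 * L * mixt h x)); last first.
      by rewrite ler_wpM2l// mulr_ge0.
    have := ler_wpM2l f0 q'L; lra.
  rewrite normrM; apply: le_trans (ler_pM _ _ q2 dB) _ => //.
  by rewrite le_eqVlt; apply/orP; left; apply/eqP; ring.
apply: le_trans (ler_norm_sum _ _ _) _; apply: ler_sum => k _ /=.
set z := x + _.
have f0 := mix_ge0 g p0 (y^~ t) z.
have /andP[q0 qL] := q_bnd f0.
have /andP[q'0 q'L] := q'_bnd f0.
have fE : mixt t z <= expR g * mix (g / 2) p (y^~ t) x.
  apply: mix_le_mix_half => // i.
  rewrite (_ : _ - _ = - ((h - t) *: delta_mx ord0 k)); last first.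
    by apply/rowP => l; rewrite /z !mxE; ring.
  rewrite sqnormN /sqnorm (bigD1 k)//= big1 ?addr0; last first.
    by move=> l lk; rewrite !mxE (negbTE lk) andbF mulr0 expr0n.
  by rewrite !mxE !eqxx mulr1 -real_normK ?num_real// expr_le1.
have gB := gmix_le g0 p0 (y^~ t) k z.
have fB := flux_le g p0 (y^~ t) z (fun i => vtB i k).
have gfB := gflux_le g0 p0 (y^~ t) z (fun i => vtB i k).
rewrite -!DE in gB gfB.
apply: (@le_trans _ _ (2 * L * B * D * mixt t z)); last first.
  by rewrite -[leRHS]mulrA ler_wpM2l// !mulr_ge0.
apply: le_trans (ler_normD _ _) _; rewrite !normrM (ger0_norm q'0) (ger0_norm q0).
have e1 : q' (mixt t z) * `|gmix g p (y^~ t) k z| * `|flux g p (y^~ t) (v^~ t) k z| <=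
    L * D * (B * mixt t z).
  by apply: ler_pM => //; [exact: mulr_ge0|exact: ler_pM].
have e2 : q (mixt t z) * `|gflux g p (y^~ t) (v^~ t) k z| <= L * mixt t z * (B * D).
  by apply: ler_pM.
apply: le_trans (lerD e1 e2) _.
by rewrite le_eqVlt; apply/orP; left; apply/eqP; ring.
Qed.

Let profile_int_derive (t : R) : 0 < t -> t < 1 ->
  derivable profile_int t 1 /\ 0 <= derive1 profile_int t.
Proof.
move=> t0 t1.
have [B [B0 nB]] := near_bounded t0 t1.
have [e /= e0 He] : exists2 e : R, 0 < e & forall h, `|t - h| < e ->
   (0 < h /\ h < 1) /\ [/\ `|h - t| <= 1, (forall i k, `|v i h ord0 k| <= B) &
    (forall i, sqnorm (y i h - y i t) <= 1)].
  have [e /= e0 He] : \forall h \near t,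
   (0 < h /\ h < 1) /\ [/\ `|h - t| <= 1, (forall i k, `|v i h ord0 k| <= B) &
    (forall i, sqnorm (y i h - y i t) <= 1)].
    near=> h; do 2?split.
    - by near: h; exact: lt_nbhsr.
    - by near: h; exact: lt_nbhsl.
    - rewrite distrC ltW//; near: h; exact: (@nbhsx_ballx _ _ t 1 ltr01).
    - by near: h.
    - by near: h; exact: near_close.
  by exists e.
have vtB i k : `|v i t ord0 k| <= B.
  by have [|_ []] // := He t; rewrite subrr normr0.
have [K K0 HK] := dPsi_bnd t0 t1 B0 vtB.
have abP h : `]t - e, t + e[%classic h -> `|t - h| < e.
  by rewrite /= in_itv/= => /andP[h1 h2]; rewrite ltr_distl; lra.
have tab : `]t - e, t + e[%classic t by rewrite /= in_itv/=; lra.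
have intu h : (@lebesgue_rV R n).-integrable setT (EFin \o (fun x =>
    \sum_(k < n) u t k (x + (h - t) *: delta_mx ord0 k))).
  rewrite (_ : EFin \o _ = fun x => (\sum_(k < n)
     (EFin \o (fun x => u t k (x + (h - t) *: delta_mx ord0 k))) x)%E).
    apply: integrable_sum => // k _; apply: integrable_shift_rV.
    exact: (@integrable_u t k B).
  by apply/funext => x; rewrite /= sumEFin.
have intPsi h : (@lebesgue_rV R n).-integrable setT (EFin \o Psi t h).
  exact: (integrableD measurableT (integrable_profile h) (intu h)).
have intG : (@lebesgue_rV R n).-integrable setT
    (EFin \o (fun x => K * mix (g / 2) p (y^~ t) x)).
  apply: (integrableZl measurableT K (f := EFin \o mix (g / 2) p (y^~ t))).
  by apply: integrable_mix; rewrite divr_gt0.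
have G0 x : 0 <= K * mix (g / 2) p (y^~ t) x by rewrite mulr_ge0// mix_ge0.
have derPsi (h : R) x : `]t - e, t + e[%classic h -> [set: 'rV[R]_n] x ->
    derivable (Psi t ^~ x) h 1.
  by move=> /abP/He[[h0 h1] _] _; have [] := is_derive_Psi t x h0 h1.
have partialE (h : R) x : 0 < h -> h < 1 ->
    partial1of2 (Psi t) h x = dPsi t h x.
  by move=> h0 h1; rewrite partial1of2E; have [_ ->] := is_derive_Psi t x h0 h1.
have GK (h : R) x : `]t - e, t + e[%classic h -> [set: 'rV[R]_n] x ->
    `|partial1of2 (Psi t) h x| <= K * mix (g / 2) p (y^~ t) x.
  move=> /abP/He[[h0 h1] [ht vB yB]] _; rewrite partialE//; exact: HK.
pose H h := \int[@lebesgue_rV R n]_x Psi t h x.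
pose c0 := \sum_(k < n) \int[@lebesgue_rV R n]_x u t k x.
have uE h : \int[@lebesgue_rV R n]_x
    (\sum_(k < n) u t k (x + (h - t) *: delta_mx ord0 k)) = c0.
  rewrite Rintegral_sumr; last first.
    by move=> k; apply: integrable_shift_rV; exact: (@integrable_u t k B).
  by apply: eq_bigr => k _; rewrite Rintegral_shift_rV.
have HE h : H h = profile_int h + c0.
  by rewrite -(uE h) -RintegralD.
have FE : profile_int = H - cst c0.
  by apply/funext => h; rewrite !fctE HE addrK.
have dH : derivable H t 1.
  exact: (derivable_under_integral measurableT tab (fun h _ => intPsi h) derPsi G0 intG GK).
have dHE : derive1 H t = \int[@lebesgue_rV R n]_x partial1of2 (Psi t) t x.
  apply/cvg_lim => //.
  exact: (cvg_differentiation_under_integral measurableT tab (fun h _ => intPsi h)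
    derPsi G0 intG GK).
have dc : derivable (cst c0 : R -> R) t 1 by [].
rewrite FE; split; first exact: derivableB.
rewrite derive1E deriveB// derive_cst subr0 -derive1E dHE.
apply: Rintegral_ge0 => x _; rewrite partialE//; exact: dPsi_ge0.
Unshelve. all: by end_near. Qed.

Let profile_int_continuous : continuous profile_int.
Proof.
move=> t.
have [e /= e0 He] := near_close t.
have abP h : `]t - e, t + e[%classic h -> `|t - h| < e.
  by rewrite /= in_itv/= => /andP[h1 h2]; rewrite ltr_distl; lra.
have tab : t \in `]t - e, t + e[%classic by rewrite inE/= in_itv/=; lra.
have M0 : 0 <= M by exact: sumr_ge0.
pose G x := L * M * (expR g * mix (g / 2) p (y^~ t) x).
have cf : {ae @lebesgue_rV R n, forall x, [set: 'rV[R]_n] x ->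
    {in `]t - e, t + e[%classic, continuous (fun h => mixt h x * q (mixt h x))}}.
  apply: aeW => x _ h _.
  have cm : mixt h' x @[h' --> h] --> mixt h x.
    apply: cvg_sumr => i; apply: cvgM; first exact: cvg_cst.
    by apply: cvg_gkerB => k; exact: cy.
  apply: cvgM; first exact: cm.
  by apply: continuous_cvg; [exact: cq|exact: cm].

have iG : (@lebesgue_rV R n).-integrable setT (EFin \o G).
  rewrite (_ : EFin \o _ = (fun x => ((L * M * expR g)%:E *
      (EFin \o mix (g / 2) p (y^~ t)) x)%E)).
    by apply: integrableZl => //; apply: integrable_mix; rewrite divr_gt0.
  by apply/funext => x; rewrite /= -EFinM /G mulrA.

have fG h : `]t - e, t + e[%classic h -> {ae @lebesgue_rV R n, forall x,
    [set: 'rV[R]_n] x -> `|mixt h x * q (mixt h x)| <= G x}.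
  move=> /abP/He yB; apply: aeW => x _.
  have f0 := mix_ge0 g p0 (y^~ h) x; have fM := mix_le g0 p0 (y^~ h) x.
  have /andP[q0 qL] := q_bnd f0.
  rewrite normrM !ger0_norm// mulrC ler_pM//.
    by rewrite (le_trans qL)// ler_wpM2l.
  apply: mix_le_mix_half => // i.
  by rewrite (_ : _ - _ = y i h - y i t)//; apply/rowP => k; rewrite !mxE; ring.

exact: (continuity_under_integral measurableT (fun h _ => integrable_profile h) cf iG fG tab).
Qed.

Lemma profile_int_nondecreasing (t s : R) : 0 <= t -> t <= s -> s <= 1 ->
  profile_int t <= profile_int s.
Proof.
move=> t0 ts s1; apply: (@ger0_derive1_ndecr R profile_int 0 1) => //.
- by move=> x; rewrite in_itv/= => /andP[x0 x1]; have [] := profile_int_derive x0 x1.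
- by move=> x; rewrite in_itv/= => /andP[x0 x1]; have [] := profile_int_derive x0 x1.
- by apply: continuous_subspaceT => x; exact: profile_int_continuous.
Qed.

Lemma profile_integral_nondecreasing (t s : R) : 0 <= t -> t <= s -> s <= 1 ->
  (\int[@lebesgue_rV R n]_x (mixt t x * q (mixt t x))%:E <=
   \int[@lebesgue_rV R n]_x (mixt s x * q (mixt s x))%:E)%E.
Proof.
move=> t0 ts s1.
pose F h := (\int[@lebesgue_rV R n]_x (mixt h x * q (mixt h x))%:E)%E.
have F_fin h : F h \is a fin_num.
  exact: (integrable_fin_num measurableT (integrable_profile h)).
have FE h : F h = (profile_int h)%:E by rewrite -[LHS]fineK.
change (F t <= F s)%E; rewrite !FE lee_fin.
exact: profile_int_nondecreasing.
Qed.

End finite_contraction.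

(** * Sigmoidal profiles *)

Section sigmoid.
Variable R : realType.

Let expr_le1D (z : R) k : 0 <= z -> z ^+ k <= 1 + z ^+ k.+1.
Proof.
move=> z0; have [z1|/ltW z1] := leP z 1.
  by rewrite (le_trans (exprn_ile1 _ z0 z1))// lerDl exprn_ge0.
by rewrite (@le_trans _ _ (z ^+ k.+1))// ?lerDr// ler_weXn2l.
Qed.

(** A smooth nondecreasing approximation of the indicator function of the ray
    beyond [b]. The exponent is even and positive, so that the denominator
    vanishes nowhere on the line. *)
Definition sigmoid (b : R) (m : nat) (r : R) : R :=
  1 - (1 + (r / b) ^+ (m.+1).*2)^-1.

(** The derivative of [sigmoid b m]. *)
Definition dsigmoid (b : R) (m : nat) (r : R) : R :=
  ((m.+1).*2%:R * (r / b) ^+ (m.+1).*2.-1 / b) * (1 + (r / b) ^+ (m.+1).*2) ^- 2.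

Let den_gt0 b m (r : R) : 0 < 1 + (r / b) ^+ (m.+1).*2.
Proof. by rewrite -muln2 exprM ltr_wpDr// sqr_ge0. Qed.

Lemma is_derive_sigmoid b m (r : R) :
  is_derive r 1 (sigmoid b m) (dsigmoid b m r).
Proof.
have dl : is_derive r 1 (fun r : R => r / b) b^-1.
  have := @is_deriveZ _ _ _ (@id R) (b^-1) r 1 _ (is_derive_id _ _).
  rewrite (_ : _ \*: _ = fun r => r / b); last first.
    by apply/funext => x; rewrite mulrC.
  by move/is_derive_eq; apply; rewrite /GRing.scale/= mulr1.
have dX : is_derive r 1 (fun s : R => (s / b) ^+ (m.+1).*2)
    ((m.+1).*2%:R * (r / b) ^+ (m.+1).*2.-1 * b^-1).
  have := @is_deriveX _ _ (fun r : R => r / b) (m.+1).*2 r 1 _ dl.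
  rewrite (_ : _ ^+ (m.+1).*2 = fun s : R => (s / b) ^+ (m.+1).*2)//.
  by apply/funext => s; rewrite exprfctE.
have dD := @is_deriveD R R R (cst 1) _ r 1 _ _ (is_derive_cst _ _ _) dX.
have dV : is_derive r 1 (fun s : R => (1 + (s / b) ^+ (m.+1).*2)^-1) (- dsigmoid b m r).
  apply: is_derive_eq.
    exact: (@is_deriveV R _ r _ 1 (lt0r_neq0 (den_gt0 b m r)) dD).
  by rewrite /dsigmoid /GRing.scale/= add0r mulrC mulrN.
have := @is_deriveB R R R (cst 1) _ r 1 _ _ (is_derive_cst _ _ _) dV.
by move/is_derive_eq; apply; rewrite sub0r opprK.
Qed.

Lemma sigmoid_ge0_le1 b m (r : R) : 0 <= sigmoid b m r <= 1.
Proof.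
have D0 := den_gt0 b m r; rewrite /sigmoid; set D := 1 + _ in D0 *.
have D1 : 1 <= D by rewrite lerDl -muln2 exprM sqr_ge0.
by rewrite subr_ge0 invf_le1// D1/= lerBlDr lerDl invr_ge0 ltW.
Qed.

Lemma sigmoid_bnd b m (r : R) : 0 < b -> 0 <= r ->
  0 <= sigmoid b m r <= (m.+1).*2%:R / b * r.
Proof.
move=> b0 r0; have /andP[-> _]/= := sigmoid_ge0_le1 b m r.
have -> : sigmoid b m r = (r / b) ^+ (m.+1).*2 / (1 + (r / b) ^+ (m.+1).*2).
  by rewrite /sigmoid; field; rewrite gt_eqF.
have z0 : 0 <= r / b by rewrite divr_ge0// ltW.
rewrite -mulrA [b^-1 * r]mulrC; set z := r / b in z0 *.
apply: (@le_trans _ _ z); last by rewrite ler_peMl// ler1n.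
rewrite ler_pdivrMr ?den_gt0// doubleS [leLHS]exprS ler_wpM2l//.
exact: expr_le1D.
Qed.

Lemma dsigmoid_bnd b m (r : R) : 0 < b -> 0 <= r ->
  0 <= dsigmoid b m r <= (m.+1).*2%:R / b.
Proof.
move=> b0 r0; rewrite /dsigmoid; have := den_gt0 b m r.
have z0 : 0 <= r / b by rewrite divr_ge0// ltW.
set z := r / b in z0 *; set D := 1 + _ => D0.
rewrite mulr_ge0 ?invr_ge0 ?exprn_ge0 ?mulr_ge0 ?invr_ge0 ?(ltW b0) ?(ltW D0)//=.
rewrite -!mulrA ler_wpM2l// mulrCA ler_piMr ?invr_ge0 ?(ltW b0)//.
rewrite ler_pdivrMr ?exprn_gt0// mul1r.
have D1 : 1 <= D by rewrite /D lerDl exprn_ge0.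
apply: (@le_trans _ _ D); last by rewrite expr2 ler_peMl// ltW.
  by rewrite /D doubleS/=; exact: expr_le1D.
exact: exprn_ge0.
Qed.

Lemma measurable_sigmoid b m : measurable_fun setT (sigmoid b m).
Proof.
apply: continuous_measurable_fun => r; apply: differentiable_continuous.
by apply/derivable1_diffP; have [] := is_derive_sigmoid b m r.
Qed.

Let leq_double_succ m : (m <= (m.+1).*2)%N.
Proof. by rewrite -addnn (leq_trans (leqnSn m))// leq_addr. Qed.

(** The pointwise limit of the sigmoids on the nonnegative reals, with the
    value 1/2 at the jump. *)
Definition half_step (b r : R) : R :=
  if r < b then 0 else if r == b then 2^-1 else 1.

Lemma cvg_sigmoid b (r : R) : 0 < b -> 0 <= r ->
  sigmoid b m r @[m --> \oo] --> half_step b r.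
Proof.
move=> b0 r0; have z0 : 0 <= r / b by rewrite divr_ge0// ltW.
rewrite /half_step; case: ltgtP => rb.
- have z1 : `|r / b| < 1 by rewrite ger0_norm// ltr_pdivrMr// mul1r.
  have c2 : (r / b) ^+ (m.+1).*2 @[m --> \oo] --> 0.
    apply: (@squeeze_cvgr _ _ _ _ (cst 0) (fun m => (r / b) ^+ m)).
    - near=> m; rewrite exprn_ge0//= ler_wiXn2l ?leq_double_succ//.
      by rewrite ltW// -(ger0_norm z0).
    - exact: cvg_cst.
    - exact: cvg_expr.
  rewrite -[X in _ --> X](_ : 1 - (1 + 0)^-1 = 0); last by rewrite addr0 invr1 subrr.
  apply: cvgB; first exact: cvg_cst.
  apply: cvgV; first by rewrite addr0 oner_eq0.
  by apply: cvgD => //; exact: cvg_cst.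
- have z1 : 1 < r / b by rewrite ltr_pdivlMr// mul1r.
  have zi0 : 0 <= (r / b)^-1 by rewrite invr_ge0.
  have zi1 : `|(r / b)^-1| < 1 by rewrite ger0_norm// invf_lt1// (lt_trans ltr01).
  have c2 : (1 + (r / b) ^+ (m.+1).*2)^-1 @[m --> \oo] --> 0.
    apply: (@squeeze_cvgr _ _ _ _ (cst 0) (fun m => (r / b)^-1 ^+ m)).
    - near=> m; rewrite invr_ge0 ltW/=; last exact: den_gt0.
      rewrite exprVn lef_pV2 ?posrE//; last by rewrite exprn_gt0// (lt_trans ltr01).
      apply: (@le_trans _ _ ((r / b) ^+ (m.+1).*2)); last by rewrite lerDr.
      by rewrite ler_weXn2l ?leq_double_succ// ltW.
    - exact: cvg_cst.
    - exact: cvg_expr.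
  rewrite -[X in _ --> X](_ : 1 - 0 = 1); last by rewrite subr0.
  by apply: cvgB => //; exact: cvg_cst.
- rewrite rb (_ : sigmoid b ^~ b = cst 2^-1); first exact: cvg_cst.
  by apply/funext => m; rewrite /sigmoid divff ?gt_eqF// expr1n /=; field.
Unshelve. all: by end_near. Qed.

End sigmoid.

(** * From sigmoidal profiles to convex functions *)

(** Here [k] may be unbounded near 0, so that the function is not monotone on the
    whole line. *)
Lemma nonincreasing_pos_measurable (R : realType) (k : R -> R) :
  (forall r s, 0 < r -> r <= s -> k s <= k r) ->
  measurable_fun setT (fun r : R => if 0 < r then k r else 0).
Proof.
move=> k_ni.
apply: measurable_fun_if => //; first exact: measurable_fun_ltr.
rewrite setTI (_ : _ @^-1` _ = `]0, +oo[%classic); last first.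
  by apply/seteqP; split => r /=; rewrite in_itv/= andbT.
apply: (measurability (@RGenCInfty.G R)) => [|/= _ [_] [r] -> <-].
  exact: RGenCInfty.measurableE.
apply: is_interval_measurable => s t/=.
rewrite !in_itv/= !andbT => -[s0 fs] [t0 ft] u /andP[su ut].
rewrite !in_itv/= !andbT; have u0 : 0 < u by exact: lt_le_trans su.
by split => //; rewrite (le_trans ft)// k_ni.
Qed.

(** A chord from the origin gets steeper. *)
Lemma convex_slope_le (R : realType) (phi : R -> R) :
  convex_function (`[0, +oo[%classic : set R) phi -> phi 0 = 0 ->
  forall r s, 0 < r -> r <= s -> phi r / r <= phi s / s.
Proof.
move=> cphi phi0 r s r0 rs; have s0 : 0 < s by exact: lt_le_trans rs.
have h0 : 0 <= r / s by rewrite divr_ge0// ltW.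
have h1 : r / s <= 1 by rewrite ler_pdivrMr// mul1r.
have sI : s \in (`[0, +oo[%classic : set R) by rewrite inE/= in_itv/= ltW.
have I0 : 0 \in (`[0, +oo[%classic : set R) by rewrite inE/= in_itv/= lexx.
have : phi (r / s * s + (1 - r / s) * 0) <= r / s * phi s + (1 - r / s) * phi 0.
  exact: (cphi (Itv01 h0 h1) s 0 sI I0).
rewrite phi0 !mulr0 !addr0 divfK ?gt_eqF// => phirs.
by rewrite ler_pdivrMr// (_ : phi s / s * r = r / s * phi s)//; ring.
Qed.

(** Two probability densities [f1] and [f2] over a sigma-finite measure, compared
    through the integrals of f q(f) for nondecreasing profiles q. *)
Section profile_comparison.
Context d (T : measurableType d) (R : realType).
Variable mu : {sigma_finite_measure set T -> \bar R}.
Variables f1 f2 : T -> R.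
Hypotheses (mf1 : measurable_fun setT f1) (mf2 : measurable_fun setT f2).
Hypotheses (f1_ge0 : forall x, 0 <= f1 x) (f2_ge0 : forall x, 0 <= f2 x).
Hypotheses (f1_int : (\int[mu]_x (f1 x)%:E = 1)%E) (f2_int : (\int[mu]_x (f2 x)%:E = 1)%E).

(** The comparison of [f1] and [f2] for one profile. *)
Definition profile_le (q : R -> R) :=
  (\int[mu]_x (f1 x * q (f1 x))%:E <= \int[mu]_x (f2 x * q (f2 x))%:E)%E.

Let integrable_ge0 (f : T -> R) : measurable_fun setT f -> (forall x, 0 <= f x) ->
  (\int[mu]_x (f x)%:E = 1)%E -> mu.-integrable setT (EFin \o f).
Proof.
move=> mf f0 f_int; apply/integrableP; split; first exact/measurable_EFinP.
under eq_integral do rewrite gee0_abs ?lee_fin//.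
by rewrite f_int ltry.
Qed.

Lemma profile_le_lim (q_ : nat -> R -> R) (q : R -> R) :
  (forall m, measurable_fun setT (q_ m)) ->
  (forall m r, 0 <= r -> 0 <= q_ m r <= 1) ->
  (forall r, 0 <= r -> q_ m r @[m --> \oo] --> q r) ->
  (forall m, profile_le (q_ m)) -> profile_le q.
Proof.
move=> mq q01 qq le_q.
have lim (f : T -> R) : measurable_fun setT f -> (forall x, 0 <= f x) ->
    (\int[mu]_x (f x)%:E = 1)%E ->
    (\int[mu]_x (f x * q_ m (f x))%:E)%E @[m --> \oo] --> (\int[mu]_x (f x * q (f x))%:E)%E.
  move=> mf f0 f_int.
  apply: (@dominated_cvg _ _ _ mu setT measurableT
    (fun m => EFin \o (fun x => f x * q_ m (f x))) _ (EFin \o f)) => //.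
  - move=> m; apply/measurable_EFinP; apply: measurable_funM => //.
    exact: measurableT_comp.
  - move=> x _; apply: cvg_EFin; first exact: nearW.
    by apply: cvgM; [exact: cvg_cst|exact: qq].
  - exact: integrable_ge0.
  - move=> m x _; have /andP[q0 q1] := q01 m _ (f0 x).
    by rewrite /= lee_fin ger0_norm ?mulr_ge0// ler_piMr.
apply: (lee_cvg_to (lim f1 mf1 f1_ge0 f1_int) (lim f2 mf2 f2_ge0 f2_int)).
by apply: nearW => m; exact: le_q.
Qed.

Hypothesis sig_le : forall b m, 0 < b -> profile_le (sigmoid b m).

Lemma half_step_le b : 0 < b -> profile_le (half_step b).
Proof.
move=> b0; apply: (@profile_le_lim (sigmoid b)).
- by move=> m; exact: measurable_sigmoid.
- by move=> m r _; exact: sigmoid_ge0_le1.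
- by move=> r r0; exact: cvg_sigmoid.
- by move=> m; exact: sig_le.
Qed.

Let half_step01 b (r : R) : 0 <= half_step b r <= 1.
Proof. by rewrite /half_step; case: ltgtP => _; lra. Qed.

Let measurable_half_step b : measurable_fun setT (@half_step R b).
Proof.
apply: nondecreasing_measurable => // r s rs.
rewrite /half_step; case: (ltgtP r b) => rb; case: (ltgtP s b) => sb; lra.
Qed.

(** Open rays are approached by half-steps that jump a little later, closed rays
    by half-steps that jump a little earlier. *)
Lemma upper_ray_le (b : R) : 0 <= b -> profile_le (fun r : R => (b < r)%R%:R).
Proof.
move=> b0; apply: (@profile_le_lim (fun m => half_step (b + m.+1%:R^-1))).
- by move=> m; exact: measurable_half_step.
- by move=> m r _; exact: half_step01.
- move=> r r0; apply: cvg_near_cst.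
  have [rb|br] := leP r b.
    apply: nearW => m; rewrite /half_step (le_lt_trans rb)//.
    by rewrite ltrDl invr_gt0 ltr0n.
  have rb0 : 0 < r - b by rewrite subr_gt0.
  near=> m; have : m.+1%:R^-1 < r - b.
    near: m; exact: near_infty_natSinv_lt (PosNum rb0).
  by rewrite /half_step ltrBrDl => brm; case: ltgtP brm.
- by move=> m; apply: half_step_le; rewrite ltr_wpDl// invr_gt0 ltr0n.
Unshelve. all: by end_near. Qed.

Lemma closed_upper_ray_le (b : R) : 0 < b -> profile_le (fun r : R => (b <= r)%R%:R).
Proof.
move=> b0; apply: (@profile_le_lim (fun m => half_step (b / (1 + m.+1%:R^-1)))).
- by move=> m; exact: measurable_half_step.
- by move=> m r _; exact: half_step01.
- have m0 m : 0 < 1 + m.+1%:R^-1 :> R by rewrite addr_gt0// invr_gt0 ltr0n.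
  move=> r r0; apply: cvg_near_cst.
  have [br|rb] := leP b r.
    apply: nearW => m; have : b / (1 + m.+1%:R^-1) < r.
      apply: lt_le_trans br; rewrite ltr_pdivrMr// ltr_pMr// ltrDl.
      by rewrite invr_gt0 ltr0n.
    by rewrite /half_step; case: ltgtP.
  have [->|r_gt0] := eqVneq r 0.
    by apply: nearW => m; rewrite /half_step divr_gt0.
  have {}r_gt0 : 0 < r by rewrite lt_def r_gt0.
  have rb0 : 0 < b / r - 1 by rewrite subr_gt0 ltr_pdivlMr// mul1r.
  near=> m; have : m.+1%:R^-1 < b / r - 1.
    near: m; exact: near_infty_natSinv_lt (PosNum rb0).
  rewrite /half_step ltrBrDl ltr_pdivlMr// mulrC => brm.
  by rewrite ltr_pdivlMr// brm.
- move=> m; apply: half_step_le; rewrite divr_gt0// addr_gt0// invr_gt0 ltr0n//.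
Unshelve. all: by end_near. Qed.

(** An up-closed set of positive numbers is empty, or an open or closed ray. *)
Lemma up_set_le (U : set R) :
  (forall r s, U r -> r <= s -> U s) -> (forall r, U r -> 0 < r) ->
  profile_le (\1_U).
Proof.
move=> up pos; have [->|/set0P U0] := eqVneq U set0.
  by rewrite /profile_le indic0; under eq_integral do rewrite mulr0;
     under [leRHS]eq_integral do rewrite mulr0.
have hi : has_inf U by split => //; exists 0 => r /pos/ltW.
have i0 : 0 <= inf U by apply: lb_le_inf => // r /pos/ltW.
have [Ui|nUi] := pselect (U (inf U)).
  rewrite (_ : \1_U = (fun r : R => (inf U <= r)%R%:R)).
    by apply: closed_upper_ray_le; exact: pos.
  apply/funext => r; rewrite indicE; congr (_%:R); congr nat_of_bool.
  apply/idP/idP; rewrite inE => Ur; first exact: (ge_inf hi.2).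
  exact: up Ui _.
rewrite (_ : \1_U = (fun r : R => (inf U < r)%R%:R)).
  exact: upper_ray_le.
apply/funext => r; rewrite indicE; congr (_%:R); congr nat_of_bool.
apply/idP/idP; rewrite inE => Ur.
  rewrite lt_neqAle (ge_inf hi.2)// andbT.
  by apply: contra_notN nUi => /eqP ->.
have [s Us sr] := inf_lt U0 Ur; exact: up Us (ltW sr).
Qed.

Section layers.
Variable k : R -> R.
Hypothesis k_ni : forall r s, 0 < r -> r <= s -> k s <= k r.
Hypothesis k_ge0 : forall r, 0 < r -> 0 <= k r.
Hypothesis mk : measurable_fun setT k.

(** The layer-cake decomposition of f k(f) for a nonnegative [k]: integrating
    [layer f] over its second argument gives f k(f). *)
Let layer (f : T -> R) (p : T * measurableTypeR R) : \bar R :=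
  (f p.1 * (if (0 <= p.2) && (p.2 < k (f p.1)) then 1 else 0))%:E.

Let measurable_layer f : measurable_fun setT f -> measurable_fun setT (layer f).
Proof.
move=> mf; apply/measurable_EFinP; apply: measurable_funM.
  exact: (measurableT_comp mf measurable_fst).
have m2 : measurable_fun setT (fun p : T * measurableTypeR R => p.2 : R).
  exact: measurable_snd.
apply: measurable_fun_ifT => //; apply: measurable_and.
  by apply: measurable_fun_ler => //.
apply: measurable_fun_ltr => //.
apply: (measurableT_comp mk); exact: (measurableT_comp mf measurable_fst).
Qed.

Let layer_ge0 f p : (forall x, 0 <= f x) -> (0 <= layer f p)%E.
Proof.
by move=> f0; rewrite lee_fin mulr_ge0//; case: ifP.
Qed.

Let layer_cake (f : T -> R) x : (forall x, 0 <= f x) ->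
  (\int[@lebesgue_measure R]_l layer f (x, l) = (f x * k (f x))%:E)%E.
Proof.
move=> f0; have [fx0|fx0] := eqVneq (f x) 0.
  rewrite fx0 mul0r; under eq_integral do rewrite /layer/= fx0 mul0r.
  by rewrite integral0.
have {}fx0 : 0 < f x by rewrite lt_def fx0 f0.
transitivity (\int[@lebesgue_measure R]_l
   ((f x)%:E * (\1_(`[0%R, k (f x)[%classic) l)%:E))%E.
  apply: eq_integral => l _; rewrite /layer/= -EFinM indicE; congr (_ * _)%:E.
  by rewrite mem_setE in_itv/=; case: ifP.
rewrite ge0_integralZl//; last by rewrite lee_fin ltW.
  rewrite integral_indic// setIT EFinM; congr (_ * _)%E.
  transitivity (lebesgue_measure (`[0, k (f x)[%classic : set R)) => //.
  rewrite lebesgue_measure_itv/= lte_fin.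
  have := k_ge0 fx0; rewrite le_eqVlt => /predU1P[<-|->]; first by rewrite ltxx.
  by rewrite sube0.
by apply/measurable_EFinP; exact: measurable_indic.
Qed.

(** At a nonnegative level [l] the layer is f minus its restriction to
    {k(f) <= l}, and {k <= l} is up-closed because [k] is nonincreasing. *)
Let layer_le l :
  (\int[mu]_x layer f2 (x, l) <= \int[mu]_x layer f1 (x, l))%E.
Proof.
have [l0|l0] := ltP l 0.
  have E (f : T -> R) : (\int[mu]_x layer f (x, l) = 0)%E.
    by under eq_integral do rewrite /layer/= leNgt l0/= mulr0; rewrite integral0.
  by rewrite !E.
pose U := [set r | 0 < r /\ k r <= l].
have mU : measurable_fun setT (\1_U : R -> R).
  apply: measurable_indic; apply: is_interval_measurable => s t [s0 ks] [t0 kt] u /andP[su ut].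
  have u0 : 0 < u by exact: lt_le_trans su.
  by split => //; rewrite (le_trans (k_ni s0 su)).
have leU : profile_le (\1_U).
  apply: up_set_le => [r s [r0 kr] rs|r []//].
  by split; [exact: lt_le_trans rs|rewrite (le_trans (k_ni r0 rs))].
have E (f : T -> R) : measurable_fun setT f -> (forall x, 0 <= f x) ->
    (\int[mu]_x (f x)%:E = 1)%E ->
    (\int[mu]_x layer f (x, l) = 1 - \int[mu]_x (f x * \1_U (f x))%:E)%E.
  move=> mf f0 f_int; have intf := integrable_ge0 mf f0 f_int.
  rewrite -f_int -integralB_EFin//.
    apply: eq_integral => x _; rewrite /layer/= l0/= -EFinB; congr EFin.
    have [fx0|fx0] := eqVneq (f x) 0; first by rewrite fx0 !mul0r subrr.
    have {}fx0 : 0 < f x by rewrite lt_def fx0 f0.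
    rewrite indicE /U; case: ltP => kl.
      by rewrite memNset ?mulr0 ?mulr1 ?subr0//= => -[_]; rewrite leNgt kl.
    by rewrite mem_set// mulr0 mulr1 subrr.
  apply: (le_integrable measurableT _ _ intf).
    apply/measurable_EFinP; apply: measurable_funM => //; exact: measurableT_comp.
  move=> x _ /=; have i0 : 0 <= \1_U (f x) :> R by rewrite indicE ler0n.
  rewrite lee_fin !ger0_norm ?mulr_ge0//.
  by rewrite ler_piMr// indicE lern1 leq_b1.
by rewrite !E//; apply: leeB.
Qed.

Lemma nonincreasing_profile_ge :
  (\int[mu]_x (f2 x * k (f2 x))%:E <= \int[mu]_x (f1 x * k (f1 x))%:E)%E.
Proof.
have E (f : T -> R) : measurable_fun setT f -> (forall x, 0 <= f x) ->
  (\int[mu]_x (f x * k (f x))%:E =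
   \int[@lebesgue_measure R]_l \int[mu]_x layer f (x, l))%E.
  move=> mf f0; rewrite -fubini_tonelli//; first last.
  - by move=> p; exact: layer_ge0.
  - exact: measurable_layer.
  by apply: eq_integral => x _; rewrite layer_cake.
rewrite !E//; apply: ge0_le_integral => //.
- by move=> l _; apply: integral_ge0 => x _; exact: layer_ge0.
- exact: (@measurable_fun_fubini_tonelli_G _ _ T (measurableTypeR R) R mu _
    (measurable_layer mf2) (fun p => layer_ge0 p f2_ge0)).
- exact: (@measurable_fun_fubini_tonelli_G _ _ T (measurableTypeR R) R mu _
    (measurable_layer mf1) (fun p => layer_ge0 p f1_ge0)).
Qed.

End layers.

(** With c = phi(M) / M one has phi(r) = c r - r k(r) on [0, M] for a nonnegative
    nonincreasing k. The integral of f k(f) may be infinite; then that of phi(f)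
    is -oo, since the integral of the positive part of phi(f) is finite. *)
Lemma convex_integral_le (phi : R -> R) (M : R) : 0 < M ->
  (forall x, f1 x <= M) -> (forall x, f2 x <= M) ->
  convex_function (`[0, +oo[%classic : set R) phi -> phi 0 = 0 ->
  (\int[mu]_x (phi (f1 x))%:E <= \int[mu]_x (phi (f2 x))%:E)%E.
Proof.
move=> M0 f1M f2M cphi phi0.
have slope := convex_slope_le cphi phi0.
pose c := phi M / M.
pose k r := if 0 < r then Num.max 0 (c - phi r / r) else 0.
have k_ni r s : 0 < r -> r <= s -> k s <= k r.
  move=> r0 rs; rewrite /k r0 (lt_le_trans r0 rs).
  by rewrite ge_max !le_max lexx/= lerB// ?slope// orbT.
have k0 r : 0 <= k r.
  by rewrite /k; case: ifP => // _; rewrite le_max lexx.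
have mk : measurable_fun setT k.
  rewrite (_ : k = fun r => if 0 < r then k r else 0).
    exact: nonincreasing_pos_measurable.
  by apply/funext => r; rewrite /k; case: ifP.
have phiE r : 0 <= r -> r <= M -> phi r = c * r - r * k r.
  move=> r0 rM; have [->|rn0] := eqVneq r 0; first by rewrite phi0 mulr0 mul0r subrr.
  have {}r0 : 0 < r by rewrite lt_def rn0.
  rewrite /k r0 max_r ?subr_ge0 ?slope//; field; rewrite ?gt_eqF//.
have le_k := nonincreasing_profile_ge k_ni (fun r _ => k0 r) mk.
have mfk (f : T -> R) : measurable_fun setT f -> measurable_fun setT (fun x => f x * k (f x)).
  by move=> mf; apply: measurable_funM => //; exact: measurableT_comp.
have fk0 (f : T -> R) x : (forall x, 0 <= f x) -> 0 <= f x * k (f x).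
  by move=> f0; rewrite mulr_ge0.
have phi_int (f : T -> R) : measurable_fun setT f -> (forall x, 0 <= f x) ->
    (forall x, f x <= M) -> (\int[mu]_x (f x)%:E = 1)%E ->
    (\int[mu]_x (phi (f x))%:E = c%:E - \int[mu]_x (f x * k (f x))%:E)%E.
  move=> mf f0 fM f_int; have intf := integrable_ge0 mf f0 f_int.
  have intcf : mu.-integrable setT (EFin \o (fun x => c * f x)).
    exact: (integrableZl measurableT c intf).
  have cfE : (\int[mu]_x (c * f x)%:E = c%:E)%E.
    under eq_integral do rewrite EFinM.
    by rewrite integralZl// f_int mule1.
  have phifE x : phi (f x) = c * f x - f x * k (f x) by exact: phiE.
  have [koo|/negP] := boolP (\int[mu]_x (f x * k (f x))%:E < +oo)%E.
    under eq_integral do rewrite phifE EFinB.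
    rewrite integralB_EFin//; last first.
      apply/integrableP; split; first by apply/measurable_EFinP; exact: mfk.
      by under eq_integral do rewrite gee0_abs ?lee_fin ?fk0//.
    by rewrite cfE.
  move=> /negP; rewrite -leNgt leye_eq => /eqP koo; rewrite koo/=.
  (* f k(f) <= |c f| + phi(f)^-, hence the negative part of phi(f) has an
     infinite integral. *)
  rewrite integralE; set N := (X in (_ - X)%E); suff -> : N = +oo%E.
    by rewrite /= addeNy.
  apply/eqP; rewrite -leye_eq -koo.
  have mN : measurable_fun setT (fun x => (phi (f x))%:E).
    under eq_fun do rewrite phifE.
    apply/measurable_EFinP; apply: measurable_funB; last exact: mfk.
    exact: measurable_funM.
  have le1 : (\int[mu]_x (f x * k (f x))%:E <=
     \int[mu]_x (`|c * f x|%:E + (fun x => (phi (f x))%:E)^\- x))%E.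
    apply: ge0_le_integral => //.
    - by move=> x _; rewrite lee_fin fk0.
    - by apply/measurable_EFinP; exact: mfk.
    - apply: emeasurable_funD; last exact: measurable_funeneg.
      by apply/measurable_EFinP; apply: measurableT_comp => //; exact: measurable_funM.
    - move=> x _; rewrite funenegE -EFinN -EFin_max -EFinD lee_fin.
      have -> : f x * k (f x) = c * f x - phi (f x) by rewrite phifE subKr.
      by apply: lerD; [exact: ler_norm|rewrite le_max lexx].
  rewrite ge0_integralD// in le1; last 2 first.
  - by apply/measurable_EFinP; apply: measurableT_comp => //; exact: measurable_funM.
  - exact: measurable_funeneg.
  have /integrableP[_ cfoo] := intcf.
  move: le1; rewrite koo /N; set A := (X in (_ <= X + _)%E); set B := (\int[_]_(_ in _) _)%E.
  have Afin : A \is a fin_num by rewrite ge0_fin_numE// integral_ge0.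
  have key (a b : \bar R) : a \is a fin_num -> (+oo <= a + b -> +oo <= b)%E.
    by case: a => // r _; case: b.
  exact: key.
rewrite !phi_int//; exact: leeB.
Qed.

End profile_comparison.

(** * Smooth curves on the unit interval *)

Section curves.
Variables (R : realType) (n : nat).
Implicit Types (c : R -> 'rV[R]_n) (t h : R).

(** The projection of the line onto [0, 1]; composing a curve with it freezes
    the curve outside of [0, 1]. *)
Definition clamp t : R := Num.max 0 (Num.min t 1).

Lemma clamp_ge0_le1 t : 0 <= clamp t <= 1.
Proof. by rewrite /clamp le_max lexx/= ge_max ler01/= ge_min lexx orbT. Qed.

Lemma clamp_id t : 0 <= t -> t <= 1 -> clamp t = t.
Proof. by move=> t0 t1; rewrite /clamp min_l// max_r. Qed.

Lemma clamp_contract t h : `|clamp t - clamp h| <= `|t - h|.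
Proof.
rewrite /clamp /Num.max /Num.min.
by do ?case: ifPn; rewrite -?leNgt => *; do 2?case: ler0P => *; lra.
Qed.

Lemma continuous_clamped_coord c k : {within `[0, 1], continuous c} ->
  continuous (fun t => c (clamp t) ord0 k).
Proof.
move=> /subspace_continuousP cc t.
have a01 : `[0, 1]%classic (clamp t) by rewrite /= in_itv/= clamp_ge0_le1.
have ck : c h ord0 k @[h --> within `[0, 1] (nbhs (clamp t))] --> c (clamp t) ord0 k.
  apply: (@continuous_cvg _ _ _ (within `[0, 1] (nbhs (clamp t))) _ c
    (fun M : 'rV[R]_n => M ord0 k)); first exact: coord_continuous.
  exact: cc.
apply/cvgrPdist_lt => e e0.
have /cvgrPdist_lt/(_ e e0) := ck; rewrite near_withinE => -[r /= r0 Hr].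
exists r => //= h th; apply: Hr; last by rewrite /= in_itv/= clamp_ge0_le1.
exact: le_lt_trans (clamp_contract _ _) th.
Qed.

Let near_within (t : R) (P : R -> Prop) : 0 < t -> t < 1 ->
  (\forall h \near within [set h | `[0, 1]%classic (h + t)] 0^', P h) ->
  \forall h \near 0^', P h.
Proof.
move=> t0 t1; rewrite near_withinE => H.
near=> h; have : `[0, 1]%classic (h + t) -> P h by near: h; exact: H.
apply; rewrite /= in_itv/=.
have : `|h| < t by near: h; exact: dnbhs0_lt.
have : `|h| < 1 - t by near: h; apply: dnbhs0_lt; rewrite subr_gt0.
by rewrite !ltr_norml => /andP[h1 h2] /andP[h3 h4]; apply/andP; split; lra.
Unshelve. all: by end_near. Qed.

(** At interior times the derivative relative to [0, 1] is the usual one. *)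
Lemma derivable_in_interior c t : 0 < t -> t < 1 -> derivable_in `[0, 1] c t ->
  diff_quot c t h @[h --> 0^'] --> derive_in `[0, 1] c t.
Proof.
move=> t0 t1 dc P nP.
apply: (@near_within t (fun h => P (diff_quot c t h))) => //; exact: (dc P nP).
Qed.

Lemma derivable_in_coord c t k : 0 < t -> t < 1 -> derivable_in `[0, 1] c t ->
  h^-1 *: (c (h + t) ord0 k - c t ord0 k) @[h --> 0^'] -->
    derive_in `[0, 1] c t ord0 k.
Proof.
move=> t0 t1 /(derivable_in_interior t0 t1) dc.
rewrite (_ : (fun h => _) = (fun M : 'rV[R]_n => M ord0 k) \o diff_quot c t).
  exact: (@continuous_cvg _ _ _ _ _ _ (fun M : 'rV[R]_n => M ord0 k) _
    (@coord_continuous _ 1 n ord0 k _) dc).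
by apply/funext => h; rewrite /= /diff_quot !mxE.
Qed.

Lemma is_derive_coord c t k : 0 < t -> t < 1 -> derivable_in `[0, 1] c t ->
  is_derive t 1 (fun h => c h ord0 k) (derive_in `[0, 1] c t ord0 k).
Proof.
move=> t0 t1 /(@derivable_in_coord c t k t0 t1) dck.
have dck' : h^-1 *: (c (h *: 1 + t) ord0 k - c t ord0 k) @[h --> 0^'] -->
    derive_in `[0, 1] c t ord0 k.
  by under eq_fun do rewrite [_ *: 1]mulr1.
apply: DeriveDef; first by apply/cvg_ex; eexists; exact: dck'.
exact: cvg_lim dck'.
Qed.

Lemma is_derive_clamped_coord c t k : 0 < t -> t < 1 ->
  derivable_in `[0, 1] c t ->
  is_derive t 1 (fun h => c (clamp h) ord0 k) (derive_in `[0, 1] c t ord0 k).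
Proof.
move=> t0 t1 dc; apply: near_eq_is_derive (@is_derive_coord c t k t0 t1 dc).
near=> h; rewrite clamp_id// ltW//; near: h; [exact: lt_nbhsr|exact: lt_nbhsl].
Unshelve. all: by end_near. Qed.

Lemma derivable_in_continuous_coord c t k : 0 < t -> t < 1 ->
  derivable_in `[0, 1] c t -> {for t, continuous (fun h => c h ord0 k)}.
Proof.
move=> t0 t1 dc; apply: differentiable_continuous; apply/derivable1_diffP.
by have [] := @is_derive_coord c t k t0 t1 dc.
Qed.

End curves.

(** * Approximation by finitely many points *)

(** Functions that factor through a measurable map [c] to a finite type. *)
Section finite_codes.
Context d (T : measurableType d) (I : finType) (c : T -> I).
Hypothesis mc : forall i, measurable (c @^-1` [set i]).

Lemma measurable_finite_code d' (T' : measurableType d') (F : I -> T') :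
  measurable_fun setT (fun x => F (c x)).
Proof.
move=> _ A mA; rewrite setTI.
rewrite (_ : _ @^-1` A = \bigcup_(i in [set i | A (F i)]) c @^-1` [set i]).
  exact: fin_bigcup_measurable.
apply/seteqP; split => [x Ax|x [i Ai] /= ->] //=.
by exists (c x).
Qed.

Lemma integral_finite_code (R : realType) (P : probability T R) (F : I -> R) :
  (forall i, 0 <= F i) ->
  (\int[P]_x (F (c x))%:E = (\sum_i fine (P (c @^-1` [set i])) * F i)%:E)%E.
Proof.
move=> F0.
transitivity (\int[P]_x (\sum_i (F i)%:E * (\1_(c @^-1` [set i]) x)%:E))%E.
  apply: eq_integral => x _; rewrite (bigD1 (c x))//= big1 ?adde0.
    by rewrite indicE mem_set// mule1.
  by move=> i /eqP ic; rewrite indicE memNset ?mule0//= => cxi; exact: ic.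
rewrite ge0_integral_sum//; last 2 first.
- move=> i; apply: measurable_funeM; apply/measurable_EFinP; exact: measurable_indic.
- by move=> i x _; rewrite mule_ge0// lee_fin.
rewrite -sumEFin; apply: eq_bigr => i _.
rewrite ge0_integralZl//; last 2 first.
- by apply/measurable_EFinP; exact: measurable_indic.
- by rewrite lee_fin.
rewrite integral_indic// setIT muleC EFinM fineK//.
exact: fin_num_measure.
Qed.

End finite_codes.

Section approximation.
Variables (R : realType) (n : nat) (K : set 'rV[R]_n) (k0 : 'rV[R]_n).
Hypothesis Kk0 : K k0.

Let B (N : nat) := (N * N.+1).*2.

(** The points of mesh 1 / (N + 1) that subdivide the interval [-N, N]. *)
Definition grid (N : nat) (j : nat) : R := j%:R / N.+1%:R - N%:R.

(** Codes of the cells of the grid at level [N]. *)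
Definition code_type N := {ffun 'I_n * 'I_(B N).+1 -> bool}.

(** The code of [x] records, for each coordinate, which points of the grid it
    dominates; its fibers are finite intersections of half-spaces. *)
Definition code N (x : 'rV[R]_n) : code_type N :=
  [ffun p : 'I_n * 'I_(B N).+1 => grid N p.2 <= x ord0 p.1].

Let box N (x : 'rV[R]_n) := forall i, - N%:R <= x ord0 i < N%:R.

(** A point of [K] in the bounded cell with code [w], or [k0] if there is none. *)
Definition code_pt N (w : code_type N) : 'rV[R]_n :=
  xget k0 [set k | [/\ K k, code N k = w & box N k]].

Lemma measurable_code N w : measurable (code N @^-1` [set w]).
Proof.
rewrite (_ : _ @^-1` _ = \bigcap_(p in [set: 'I_n * 'I_(B N).+1])
   (fun x : 'rV[R]_n => grid N p.2 <= x ord0 p.1) @^-1` [set w p]).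
  apply: fin_bigcap_measurable => // p _; rewrite -[X in measurable X]setTI.
  apply: measurable_fun_ler => //; exact: measurable_coord.
apply/seteqP; split => [x /= <- p _ /=|x H]; first by rewrite ffunE.
by apply/ffunP => p; rewrite ffunE; exact: (H p).
Qed.

Lemma code_pt_in N (w : code_type N) : K (code_pt w).
Proof. by rewrite /code_pt; case: xgetP => // x _ []. Qed.

Lemma code_close N x y i : code N x = code N y -> box N x ->
  `|x ord0 i - y ord0 i| <= N.+1%:R^-1.
Proof.
move=> xy bx; have /ffunP E := xy.
have N0 : 0 < N.+1%:R :> R by rewrite ltr0n.
have /andP[x1 x2] := bx i.
pose z := (x ord0 i + N%:R) * N.+1%:R.
have z0 : 0 <= z by rewrite mulr_ge0// -lerBlDr sub0r.
have zB : z < (B N)%:R.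
  by rewrite /z /B -mul2n natrM natrM mulrA ltr_pM2r// mulr_natl mulr2n ltrD2r.
have /andP[j1 j2] := truncn_itv z0; set j := Num.truncn z in j1 j2.
have jB : (j < B N)%N by rewrite -(ltr_nat R) (le_lt_trans j1).
have g1 : grid N j <= x ord0 i by rewrite /grid lerBlDr ler_pdivrMr.
have g2 : x ord0 i < grid N j.+1 by rewrite /grid ltrBrDr ltr_pdivlMr.
have jB1 : (j < (B N).+1)%N by rewrite ltnS ltnW.
have := E (i, Ordinal jB1); rewrite !ffunE/= g1 => /esym h1.
have := E (i, Ordinal (jB : (j.+1 < (B N).+1)%N)); rewrite !ffunE/= leNgt g2/=.
move=> /esym/negbT; rewrite -ltNge => h2.
have gg : grid N j.+1 = grid N j + N.+1%:R^-1.
  by rewrite /grid -natr1 mulrDl mul1r; ring.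
rewrite gg in g2 h2; have {}h1 : grid N j <= y ord0 i by rewrite h1.
move: g1 g2 h1 h2; move: (grid N j) (N.+1%:R^-1 : R) => a e g1 g2 h1 h2.
by rewrite ler_norml; apply/andP; split; lra.
Qed.

Lemma code_pt_close N x i : K x -> box N x ->
  `|code_pt (code N x) ord0 i - x ord0 i| <= N.+1%:R^-1.
Proof.
move=> Kx bx; rewrite /code_pt; case: xgetP => [k _ [Kk kx bk]|/(_ x)].
  exact: code_close.
by case.
Qed.

(** The approximation of a point is at bounded distance of it, unless it is the
    default point; this makes domination possible although [K] is unbounded. *)
Lemma code_pt_dichotomy N x : K x ->
  code_pt (code N x) = k0 \/ sqnorm (code_pt (code N x) - x) <= n%:R.
Proof.
move=> Kx; rewrite /code_pt; case: xgetP => [k _ [Kk kx bk]|_]; last by left.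
right; rewrite -[X in X%:R](card_ord n) -sumr_const; apply: ler_sum => i _.
rewrite !mxE -real_normK ?num_real// expr_le1//.
by rewrite (le_trans (code_close i kx bk))// invf_le1 ?ltr0n// ler1n.
Qed.

Lemma cvg_code_pt x i : K x ->
  code_pt (code N x) ord0 i @[N --> \oo] --> x ord0 i.
Proof.
move=> Kx; apply/cvgrPdist_le => e e0.
have nx : \forall N \near \oo, box N x.
  near=> N => j; have : `|x ord0 j| < N%:R.
    apply: (@le_lt_trans _ _ (\sum_j `|x ord0 j|)).
      by rewrite (bigD1 j)//= lerDl sumr_ge0.
    near: N; exact: nbhs_infty_gtr.
  by rewrite ltr_norml => /andP[/ltW -> ->].
have ne := near_infty_natSinv_lt (PosNum e0).
near=> N; rewrite distrC (le_trans (code_pt_close i Kx _))//; first by near: N.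
by apply: ltW; near: N; exact: ne.
Unshelve. all: by end_near. Qed.

End approximation.

(** * Gaussian convolution *)

Section contraction_extension.
Variables (R : realType) (n : nat) (K : set 'rV[R]_n) (F : 'rV[R]_n -> 'rV[R]_n).
Hypothesis Fcontr : forall x y, K x -> K y -> sqnorm (F x - F y) <= sqnorm (x - y).

Lemma cvg_contraction (z : nat -> 'rV[R]_n) x i : (forall N, K (z N)) -> K x ->
  (forall i, z N ord0 i @[N --> \oo] --> x ord0 i) ->
  F (z N) ord0 i @[N --> \oo] --> F x ord0 i.
Proof.
move=> Kz Kx zx.
have zx0 : sqnorm (z N - x) @[N --> \oo] --> (0 : R).
  have -> : (0 : R) = sqnorm (x - x).
    by rewrite subrr /sqnorm big1// => k _; rewrite mxE expr0n.
  apply: cvg_sqnorm => k; rewrite !mxE; under eq_fun do rewrite !mxE.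
  by apply: cvgB => //; exact: cvg_cst.
apply/cvgrPdist_le => e e0.
have e20 : 0 < e ^+ 2 by rewrite exprn_gt0.
have /cvgr_le/(_ _ e20) := zx0; apply: filterS => N zxN.
rewrite distrC -(@ler_pXn2r _ 2)// ?nnegrE ?(ltW e0)// real_normK ?num_real//.
have := sqr_coord_le_sqnorm (F (z N) - F x) i; rewrite !mxE => /le_trans; apply.
exact: le_trans (Fcontr (Kz N) Kx) zxN.
Qed.

(** A contraction of [K] is on [K] the limit of maps with finitely many values,
    so that a superior limit of these extends it measurably to the whole
    space. *)
Lemma contraction_measurable_extension k0 : K k0 ->
  exists2 G : 'rV[R]_n -> 'rV[R]_n, measurable_fun setT G & forall x, K x -> G x = F x.
Proof.
move=> Kk0; pose z N (x : 'rV[R]_n) := code_pt K k0 (code N x).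
exists (fun x => \row_i fine (limn_esup (fun N => (F (z N x) ord0 i)%:E))).
  apply/measurable_fun_rVP => i; under eq_fun do rewrite mxE.
  apply: (measurableT_comp (f := fine)) => //.
  apply: measurable_fun_limn_esup => N; apply/measurable_EFinP.
  have := measurable_finite_code (@measurable_code R n N)
    (fun w => F (code_pt K k0 w) ord0 i).
  exact.
move=> x Kx; apply/rowP => i; rewrite mxE.
have zx : (F (z N x) ord0 i)%:E @[N --> \oo] --> (F x ord0 i)%:E.
  apply: cvg_EFin; first exact: nearW.
  apply: cvg_contraction => // [N|j]; first exact: code_pt_in.
  exact: cvg_code_pt.
by have [_ ->] := cvg_limn_einf_sup zx.
Qed.

End contraction_extension.

Section mfun_ex.
Context d d' (T : measurableType d) (T' : measurableType d') (f : T -> T').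
Hypothesis mf : measurable_fun setT f.

Let fm := f.

HB.instance Definition _ := isMeasurableFun.Build _ _ _ _ fm mf.

(** Packages a measurable function as an element of the type of measurable
    functions. *)
Lemma mfun_ex : exists g : {mfun T >-> T'}, g = f :> (T -> T').
Proof. by exists fm. Qed.

End mfun_ex.

Section gauss_convolution.
Context d (Omega : measurableType d) (R : realType) (P : probability Omega R).
Variables (n : nat) (s : R).
Hypothesis s0 : 0 < s.

(** The normalization constant and the precision of the law of sqrt(s) Z. *)
Definition gconst : R := (Num.sqrt s)^-1 ^+ n * (2 * pi) `^ (- (n%:R / 2)).

Definition gprec : R := (2 * s)^-1.

Lemma gprec_gt0 : 0 < gprec.
Proof. by rewrite invr_gt0 mulr_gt0. Qed.

Lemma gconst_gt0 : 0 < gconst.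
Proof.
rewrite mulr_gt0 ?exprn_gt0 ?invr_gt0 ?sqrtr_gt0//.
by rewrite powR_gt0// mulr_gt0// pi_gt0.
Qed.

(** The density of Y + sqrt(s) Z, as the mean of Gaussian densities centered at
    the values of [Y]. *)
Definition smoothed_density (Y : Omega -> 'rV[R]_n) (x : 'rV[R]_n) : R :=
  gconst * fine (\int[P]_w (gker gprec (x - Y w))%:E).

Lemma gauss_density_scaled (v : 'rV[R]_n) :
  gauss_density ((Num.sqrt s)^-1 *: v) = (2 * pi) `^ (- (n%:R / 2)) * gker gprec v.
Proof.
rewrite /gauss_density norm2K; congr (_ * expR (- _)).
rewrite /sqnorm mulr_suml mulr_sumr; apply: eq_bigr => i _.
rewrite mxE exprMn exprVn sqr_sqrtr ?(ltW s0)// /gprec; field.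
by rewrite gt_eqF.
Qed.

Variable Y : {RV P >-> 'rV[R]_n}.

Lemma integral_gker_RV_le1 x : (0 <= \int[P]_w (gker gprec (x - Y w))%:E <= 1)%E.
Proof.
rewrite integral_ge0/=; last by move=> w _; rewrite lee_fin gker_ge0.
rewrite -(@probability_setT _ _ _ P) -(mul1e (P setT)) -integral_cst//.
apply: ge0_le_integral => //.
- by move=> w _; rewrite lee_fin gker_ge0.
- by apply/measurable_EFinP; exact: measurable_gkerB.
- by move=> w _; rewrite lee_fin gker_le1// ltW// gprec_gt0.
Qed.

Lemma integral_gker_RV_fin x : (\int[P]_w (gker gprec (x - Y w))%:E)%E \is a fin_num.
Proof.
have /andP[h0 h1] := integral_gker_RV_le1 x.
by rewrite ge0_fin_numE// (le_lt_trans h1)// ltry.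
Qed.

Lemma smoothed_density_ge0 x : 0 <= smoothed_density Y x.
Proof.
rewrite mulr_ge0 ?(ltW gconst_gt0)// fine_ge0//.
by have /andP[] := integral_gker_RV_le1 x.
Qed.

Lemma smoothed_density_le x : smoothed_density Y x <= gconst.
Proof.
rewrite ler_piMr ?(ltW gconst_gt0)// -lee_fin fineK ?integral_gker_RV_fin//.
by have /andP[] := integral_gker_RV_le1 x.
Qed.

Let measurable_kernel : measurable_fun setT
  (fun p : Omega * 'rV[R]_n => (gconst * gker gprec (p.2 - Y p.1))%:E).
Proof.
apply/measurable_EFinP; apply: measurable_funM => //; apply: measurable_gkerB => //.
exact: (measurableT_comp (measurable_funPT Y) measurable_fst).
Qed.

Let kernel_ge0 p : (0 <= (gconst * gker gprec (p.2 - Y p.1))%:E)%E.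
Proof. by rewrite lee_fin mulr_ge0 ?gker_ge0// ltW// gconst_gt0. Qed.

Lemma smoothed_densityE x :
  (smoothed_density Y x)%:E = (\int[P]_w (gconst * gker gprec (x - Y w))%:E)%E.
Proof.
rewrite /smoothed_density EFinM fineK ?integral_gker_RV_fin//.
under [RHS]eq_integral do rewrite EFinM.
rewrite ge0_integralZl//.
- by apply/measurable_EFinP; exact: measurable_gkerB.
- by move=> w _; rewrite lee_fin gker_ge0.
- by rewrite lee_fin ltW// gconst_gt0.
Qed.

Lemma measurable_smoothed_density : measurable_fun setT (smoothed_density Y).
Proof.
apply/measurable_EFinP; rewrite (_ : _ \o _ = fun x =>
   \int[P]_w (gconst * gker gprec (x - Y w))%:E)%E.
  exact: (@measurable_fun_fubini_tonelli_G _ _ Omega 'rV[R]_n R P _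
    measurable_kernel kernel_ge0).
by apply/funext => x /=; rewrite smoothed_densityE.
Qed.

Variable Z : {RV P >-> 'rV[R]_n}.
Hypothesis Zgauss : is_density P Z (@gauss_density R n).
Hypothesis YZ : independent_rv P Y Z.

Let prob_shift (y : 'rV[R]_n) A : measurable A ->
  P (Z @^-1` [set z | A (y + Num.sqrt s *: z)]) =
  (\int[@lebesgue_rV R n]_(x in A) (gconst * gker gprec (x - y))%:E)%E.
Proof.
move=> mA; have [mgauss gauss0 ->] := Zgauss; last first.
  have := @measurable_affine_rV R n (Num.sqrt s) y measurableT A mA.
  by rewrite setTI; under eq_fun do rewrite addrC.
have sq0 : 0 < Num.sqrt s by rewrite sqrtr_gt0.
rewrite integral_mkcond [RHS]integral_mkcond.
pose h (u : 'rV[R]_n) : \bar R :=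
  (((fun u => ((2 * pi) `^ (- (n%:R / 2)) * gker gprec (u - y))%:E) \_ A) u)%E.
transitivity (\int[@lebesgue_rV R n]_z h (Num.sqrt s *: z + y)%R)%E.
  apply: eq_integral => z _; rewrite /h /patch.
  have zE : (Num.sqrt s)^-1 *: (Num.sqrt s *: z + y - y) = z.
    by rewrite addrK scalerA mulVf ?gt_eqF// scale1r.
  rewrite -gauss_density_scaled zE; congr (if _ then _ else _).
  by apply/idP/idP; rewrite !inE/= addrC.
rewrite ge0_integral_rV_affine//.
- rewrite -ge0_integralZl//.
  + apply: eq_integral => u _; rewrite /h /patch; case: ifPn => _; last by rewrite mule0.
    by rewrite -EFinM mulrA.
  + apply/(measurable_restrictT _ mA).
    apply/measurable_EFinP; apply: measurable_funM => //.
    apply: measurable_funTS; exact: measurable_gkerB.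
  + move=> u _; rewrite /h /patch; case: ifP => // _.
    by rewrite lee_fin mulr_ge0 ?gker_ge0// powR_ge0.
- apply/(measurable_restrictT _ mA).
  apply/measurable_EFinP; apply: measurable_funM => //.
  apply: measurable_funTS; exact: measurable_gkerB.
- move=> u; rewrite /h /patch; case: ifP => // _.
  by rewrite lee_fin mulr_ge0 ?gker_ge0// powR_ge0.
Qed.

(** By independence the law of (Y, Z) is a product measure; the Gaussian integral
    over Z is an affine change of variables, and Tonelli's theorem moves the mean
    over Y inside. *)
Lemma smoothed_density_is_density :
  is_density P (fun w => Y w + Num.sqrt s *: Z w) (smoothed_density Y).
Proof.
split; [exact: measurable_smoothed_density|exact: smoothed_density_ge0|].
move=> A mA.
pose C := [set p : 'rV[R]_n * 'rV[R]_n | A (p.1 + Num.sqrt s *: p.2)].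
have mC : measurable C.
  have : measurable_fun setT (fun p : 'rV[R]_n * 'rV[R]_n => p.1 + Num.sqrt s *: p.2).
    apply/measurable_fun_rVP => i; under eq_fun do rewrite !mxE.
    apply: measurable_funD.
      exact: (measurableT_comp (measurable_coord i) measurable_fst).
    apply: measurable_funM => //.
    exact: (measurableT_comp (measurable_coord i) measurable_snd).
  by move=> /(_ measurableT A mA); rewrite setTI.
have mYZ : measurable_fun setT (fun w => (Y w, Z w)).
  exact: measurable_fun_pair.
pose law : {measure set ('rV[R]_n * 'rV[R]_n) -> \bar R} :=
  pushforward P (fun w => (Y w, Z w)).
have lawE := @product_measure_unique _ _ _ _ R (distribution P Y) (distribution P Z) (law mYZ)
  (fun A' B mA' mB => YZ mA' mB).
have -> : P ((fun w => Y w + Num.sqrt s *: Z w) @^-1` A) = law mYZ C by [].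
rewrite -lawE//.
rewrite /product_measure1/=.
rewrite ge0_integral_distribution//; last first.
  exact: measurable_fun_xsection.
transitivity (\int[P]_w \int[@lebesgue_rV R n]_x
   ((fun x => (gconst * gker gprec (x - Y w))%:E) \_ A) x)%E.
  apply: eq_integral => w _; rewrite -integral_mkcond -prob_shift//=.
  congr (P _); apply/seteqP; split => w' /=; by rewrite /xsection/= inE.
rewrite (@fubini_tonelli _ _ _ _ _ P (@lebesgue_rV R n)
  (fun p => ((fun x => (gconst * gker gprec (x - Y p.1))%:E) \_ A) p.2))/=; last 2 first.
- rewrite (_ : (fun p => _) = (fun p : Omega * 'rV[R]_n =>
    (gconst * gker gprec (p.2 - Y p.1))%:E) \_ (snd @^-1` A)).
    have mS : measurable (snd @^-1` A : set (Omega * 'rV[R]_n)).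
      by have := @measurable_snd _ _ Omega 'rV[R]_n measurableT A mA; rewrite setTI.
    by apply/(measurable_restrictT _ mS); exact: measurable_funTS.
  by apply/funext => p; rewrite /patch; congr (if _ then _ else _).
- by move=> p; rewrite /patch; case: ifP => // _; exact: (kernel_ge0 (p.1, p.2)).
rewrite [RHS]integral_mkcond; apply: eq_integral => x _.
rewrite /patch; case: ifPn => xA; first by rewrite smoothed_densityE.
by rewrite integral0.
Qed.

End gauss_convolution.

(** * Densities along a contracting flow *)

Lemma measurable_convex_comp d (T : measurableType d) (R : realType)
    (phi : R -> R) (f : T -> R) :
  convex_function (`[0, +oo[%classic : set R) phi -> phi 0 = 0 ->
  measurable_fun setT f -> (forall x, 0 <= f x) ->
  measurable_fun setT (fun x => phi (f x)).
Proof.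
move=> cphi phi0 mf f0.
have slope := convex_slope_le cphi phi0.
have mk : measurable_fun setT (fun r : R => if 0 < r then - (phi r / r) else 0).
  by apply: nonincreasing_pos_measurable => r s r0 rs; rewrite lerN2 slope.
have mkf := measurableT_comp mk mf.
rewrite (_ : (fun x => _) = (fun x => - (f x * ((fun r : R =>
    if 0 < r then - (phi r / r) else 0) \o f) x))).
  by apply: measurableT_comp => //; exact: measurable_funM.
apply/funext => x /=; have [fx0|fx0] := eqVneq (f x) 0.
  by rewrite fx0 ltxx mulr0 oppr0.
by rewrite lt_def fx0 f0/= mulrN opprK mulrC divfK.
Qed.

Lemma density_ae_eq d (Omega : measurableType d) (R : realType)
    (P : probability Omega R) n (W : Omega -> 'rV[R]_n) (f f' : 'rV[R]_n -> R) :
  is_density P W f -> is_density P W f' ->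
  ae_eq (@lebesgue_rV R n) setT (EFin \o f) (EFin \o f').
Proof.
move=> [mf f0 Wf] [mf' f'0 Wf']; apply: integral_ae_eq => //.
- apply/integrableP; split; first exact/measurable_EFinP.
  under eq_integral do rewrite gee0_abs ?lee_fin//.
  have := Wf setT measurableT; rewrite preimage_setT probability_setT => <-.
  by rewrite ltry.
- exact/measurable_EFinP.
- by move=> A _ mA; rewrite -Wf// -Wf'.
Qed.

Lemma density_integral1 d (Omega : measurableType d) (R : realType)
    (P : probability Omega R) n (W : Omega -> 'rV[R]_n) (f : 'rV[R]_n -> R) :
  is_density P W f -> (\int[@lebesgue_rV R n]_x (f x)%:E = 1)%E.
Proof.
by move=> [_ _ /(_ setT measurableT)]; rewrite preimage_setT probability_setT.
Qed.

Section contraction_flow.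
Variables (R : realType) (n : nat) (K : set 'rV[R]_n).
Variable T : R -> 'rV[R]_n -> 'rV[R]_n.
Hypothesis Tcontr : continuously_contracting K T.
Hypothesis Tsmooth : forall x, K x -> smooth_in `[0, 1] (fun t => T t x).

Lemma contracting_sqnorm x y t u : K x -> K y -> 0 <= t -> t <= u -> u <= 1 ->
  sqnorm (T u x - T u y) <= sqnorm (T t x - T t y).
Proof.
move=> Kx Ky t0 tu u1; have [_ _ H] := Tcontr.
by rewrite -!norm2K ler_pXn2r ?nnegrE ?sqrtr_ge0// H.
Qed.

Lemma flow_contraction x y t : K x -> K y -> 0 <= t -> t <= 1 ->
  sqnorm (T t x - T t y) <= sqnorm (x - y).
Proof.
move=> Kx Ky t0 t1; have [T0 _ _] := Tcontr.
have := contracting_sqnorm Kx Ky (lexx 0) t0 t1.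
by rewrite !T0.
Qed.

(** Monotonicity for a law with finitely many atoms in [K]. *)
Lemma finite_flow_profile_le (I : finType) (g : R) (p : I -> R)
    (x : I -> 'rV[R]_n) (b : R) (m : nat) (t u : R) :
  0 < g -> (forall i, 0 <= p i) -> (forall i, K (x i)) -> 0 < b ->
  0 <= t -> t <= u -> u <= 1 ->
  profile_le (@lebesgue_rV R n) (mix g p (fun i => T t (x i)))
    (mix g p (fun i => T u (x i))) (sigmoid b m).
Proof.
move=> g0 p0 Kx b0 t0 tu u1.
have [_ cT _] := Tcontr.
pose y i h := T (clamp h) (x i).
pose v i := derive_in `[0, 1] (fun t => T t (x i)).
have dT i (h : R) k : 0 < h -> h < 1 ->
    derivable_in `[0, 1] (iter k (derive_in `[0, 1]) (fun t => T t (x i))) h.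
  by move=> h0 h1; apply: Tsmooth => //=; rewrite in_itv/= !ltW.
have H := @profile_integral_nondecreasing R n I g p g0 p0 (sigmoid b m) (dsigmoid b m)
  ((m.+1).*2%:R / b) (is_derive_sigmoid b m) (fun r => @dsigmoid_bnd R b m r b0)
  (fun r => @sigmoid_bnd R b m r b0) y v.
have : (\int[@lebesgue_rV R n]_z
   (mix g p (y^~ t) z * sigmoid b m (mix g p (y^~ t) z))%:E <=
   \int[@lebesgue_rV R n]_z
   (mix g p (y^~ u) z * sigmoid b m (mix g p (y^~ u) z))%:E)%E.
  apply: H => //.
  - by move=> i k; apply: (@continuous_clamped_coord R n (fun t => T t (x i))); exact: cT.
  - move=> i k h h0 h1.
    by apply: (@is_derive_clamped_coord R n (fun t => T t (x i))) => //; exact: (dT i h 0%N).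
  - move=> i k h h0 h1.
    by apply: derivable_in_continuous_coord => //; exact: (dT i h 1%N).
  - move=> i j h h' h0 hh' h1.
    have h'0 := le_trans h0 hh'; have h'1 := le_trans hh' h1.
    by rewrite /y !clamp_id//; exact: contracting_sqnorm.
have t1 := le_trans tu u1; have u0 := le_trans t0 tu.
by rewrite /y !clamp_id.
Qed.

Context d (Omega : measurableType d) (P : probability Omega R).
Variables X Z : {RV P >-> 'rV[R]_n}.
Hypothesis XK : forall w, K (X w).
Hypothesis Zgauss : is_density P Z (@gauss_density R n).
Hypothesis XZ : independent_rv P X Z.
Variable s : R.
Hypothesis s0 : 0 < s.

Lemma inhabited_sample_space : exists x, K x.
Proof.
suff [w _] : [set: Omega] !=set0 by exists (X w).
apply/set0P/eqP => E; have := @probability_setT _ _ _ P.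
by rewrite E measure0 => /esym/eqP; rewrite onee_eq0.
Qed.

(** [T t] need not be measurable off [K], hence the recourse to an extension. *)
Lemma flow_RV t : 0 <= t -> t <= 1 ->
  exists2 Y : {RV P >-> 'rV[R]_n}, (forall w, Y w = T t (X w)) &
    independent_rv P Y Z.
Proof.
move=> t0 t1; have [k0 Kk0] := inhabited_sample_space.
have [G mG GE] := @contraction_measurable_extension R n K (T t)
  (fun x y Kx Ky => flow_contraction Kx Ky t0 t1) k0 Kk0.
have [Y YE] := mfun_ex (measurableT_comp mG (measurable_funPT X)).
exists Y; first by move=> w; rewrite YE/= GE.
move=> A B mA mB; rewrite YE comp_preimage; apply: XZ => //.
by rewrite -[X in measurable X]setTI; exact: mG.
Qed.

Local Notation g := (gprec s).

(** The density of T_t(X') + sqrt(s) Z, where X' is the approximation of [X] at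
    level [N], which has finitely many values in [K]. *)
Definition approx (k0 : 'rV[R]_n) N t : 'rV[R]_n -> R :=
  mix g (fun i : code_type n N =>
          gconst n s * fine (P ((fun w => code N (X w)) @^-1` [set i])))
        (fun i => T t (code_pt K k0 i)).

Let measurable_code_X N i : measurable ((fun w => code N (X w)) @^-1` [set i]).
Proof.
have := measurable_funPT X measurableT _ (@measurable_code R n N i).
by rewrite setTI.
Qed.

Let approx_intE k0 N t x :
  (\int[P]_w (gker g (x - T t (code_pt K k0 (code N (X w)))))%:E)%E =
  (\sum_(i : code_type n N) fine (P ((fun w => code N (X w)) @^-1` [set i])) *
     gker g (x - T t (code_pt K k0 i)))%:E.
Proof.
rewrite (@integral_finite_code _ _ _ _ (@measurable_code_X N) R P
  (fun i => gker g (x - T t (code_pt K k0 i))))// => i; exact: gker_ge0.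
Qed.

Let approx_fineE k0 N t x : approx k0 N t x = gconst n s *
  fine (\int[P]_w (gker g (x - T t (code_pt K k0 (code N (X w)))))%:E)%E.
Proof.
by rewrite approx_intE/= mulr_sumr; apply: eq_bigr => i _; rewrite mulrA.
Qed.

Let approxE k0 N t x :
  (approx k0 N t x)%:E = ((gconst n s)%:E *
    \int[P]_w (gker g (x - T t (code_pt K k0 (code N (X w)))))%:E)%E.
Proof. by rewrite approx_fineE EFinM fineK// approx_intE. Qed.

Let measurable_approx_kernel k0 N t x :
  measurable_fun setT (fun w => (gker g (x - T t (code_pt K k0 (code N (X w)))))%:E).
Proof.
exact: (measurable_finite_code (@measurable_code_X N)
  (fun i => (gker g (x - T t (code_pt K k0 i)))%:E)).
Qed.

Section fixed_time.
Variables (k0 : 'rV[R]_n) (t : R) (Y : {RV P >-> 'rV[R]_n}).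
Hypotheses (Kk0 : K k0) (t0 : 0 <= t) (t1 : t <= 1).
Hypothesis YE : forall w, Y w = T t (X w).
Hypothesis YZ : independent_rv P Y Z.

Let g0 : 0 < g. Proof. exact: gprec_gt0. Qed.

Lemma cvg_approx x : approx k0 N t x @[N --> \oo] --> smoothed_density P s Y x.
Proof.
pose u N := (\int[P]_w (gker g (x - T t (code_pt K k0 (code N (X w)))))%:E)%E.
have ul : u N @[N --> \oo] --> (\int[P]_w (gker g (x - Y w))%:E)%E.
  apply: (@dominated_cvg _ _ _ P setT measurableT
    (fun N w => (gker g (x - T t (code_pt K k0 (code N (X w)))))%:E) _ (cst 1%E)) => //.
  - by move=> w _; apply: cvg_EFin; first exact: nearW;
       rewrite YE; apply: cvg_gkerB => i;
       apply: (@cvg_contraction R n K (T t)) => // [x' y' Kx' Ky'|N|j];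
       [exact: flow_contraction|exact: code_pt_in|exact: cvg_code_pt].
  - exact: finite_measure_integrable_cst.
  - by move=> N w _; rewrite /= lee_fin ger0_norm ?gker_ge0// gker_le1// ltW.
rewrite -[X in _ --> X]/(gconst n s * fine (\int[P]_w (gker g (x - Y w))%:E)%E).
have -> : (fun N => approx k0 N t x) = (fun N => gconst n s * fine (u N)).
  by apply/funext => N; rewrite approx_fineE.
apply: cvgM; first exact: cvg_cst.
by apply: fine_cvg; rewrite fineK// integral_gker_RV_fin.
Qed.

(** The dominating function is made of the density of T_t(X) + sqrt(2 s) Z, which
    accounts for the approximations close to [X], and of the Gaussian centered at
    the default point. *)
Lemma approx_dominated : exists2 G : 'rV[R]_n -> R,
  (@lebesgue_rV R n).-integrable setT (EFin \o G) &
  forall N x, 0 <= approx k0 N t x <= G x.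
Proof.
have s20 : 0 < 2 * s by rewrite mulr_gt0.
have gs : gprec (2 * s) = g / 2 by rewrite /gprec -invfM mulrC.
pose e := expR (g * n%:R).
pose A := gconst n s * e / gconst n (2 * s).
have c0 := gconst_gt0 n s0.
have c20 := gconst_gt0 n s20.
exists (fun x => A * smoothed_density P (2 * s) Y x + gconst n s * gker g (x - T t k0)).
  have dens := smoothed_density_is_density s20 Zgauss YZ.
  have int1 : (@lebesgue_rV R n).-integrable setT (EFin \o smoothed_density P (2 * s) Y).
    apply/integrableP; split.
      by apply/measurable_EFinP; exact: measurable_smoothed_density.
    under eq_integral do rewrite /= ger0_norm ?smoothed_density_ge0//.
    by rewrite (density_integral1 dens) ltry.
  apply: (integrableD measurableT (integrableZl measurableT A int1)
    (integrableZl measurableT (gconst n s) (integrable_gker (T t k0) g0))).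
move=> N x /=; apply/andP; split.
  apply: mix_ge0 => i; rewrite mulr_ge0 ?(ltW c0)// fine_ge0//.
rewrite -lee_fin approxE EFinD [(A * _)%:E]EFinM [(_ * gker g (x - T t k0))%:E]EFinM.
rewrite /smoothed_density.
rewrite (_ : (A%:E * _)%E = ((gconst n s)%:E *
   \int[P]_w (e * gker (g / 2) (x - Y w))%:E)%E); last first.
  under [in RHS]eq_integral do rewrite EFinM.
  rewrite ge0_integralZl//; last 3 first.
  - by apply/measurable_EFinP; exact: measurable_gkerB.
  - by move=> w _; rewrite lee_fin gker_ge0.
  - by rewrite lee_fin expR_ge0.
  have fin := integral_gker_RV_fin s20 Y x; rewrite gs in fin.
  rewrite gs [(_ * fine _)%:E]EFinM fineK// !muleA -!EFinM; congr (_%:E * _)%E.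
  by rewrite /A divfK// gt_eqF.
rewrite -muleDr//; last first.
  by rewrite ge0_adde_def// inE ?lee_fin ?gker_ge0//; apply: integral_ge0 => w _;
    rewrite lee_fin mulr_ge0 ?expR_ge0 ?gker_ge0.
rewrite lee_pmul2l//.
have -> : ((gker g (x - T t k0))%:E = \int[P]_w (gker g (x - T t k0))%:E)%E.
  rewrite integral_cst// -[LHS]mule1; congr (_ * _)%E.
  exact: (esym (@probability_setT _ _ _ P)).
rewrite -ge0_integralD//; last 3 first.
- by move=> w _; rewrite lee_fin mulr_ge0 ?expR_ge0 ?gker_ge0.
- by apply/measurable_EFinP; apply: measurable_funM => //; exact: measurable_gkerB.
- by move=> w _; rewrite lee_fin gker_ge0.
apply: ge0_le_integral => //.
- by move=> w _; rewrite lee_fin gker_ge0.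
- apply: emeasurable_funD; last exact: measurable_cst.
  by apply/measurable_EFinP; apply: measurable_funM => //; exact: measurable_gkerB.
- move=> w _; rewrite lee_fin.
  have [->|close] := code_pt_dichotomy k0 N (XK w).
    by rewrite lerDr mulr_ge0 ?expR_ge0 ?gker_ge0.
  apply: (@le_trans _ _ (e * gker (g / 2) (x - Y w))); last by rewrite lerDl gker_ge0.
  apply: le_trans (gker_shift_le _ (x - Y w) (ltW g0)) _.
  rewrite ler_wpM2r ?gker_ge0// ler_expR ler_wpM2l ?(ltW g0)//.
  apply: le_trans close; rewrite YE.
  rewrite (_ : _ - _ = T t (code_pt K k0 (code N (X w))) - T t (X w)).
    by apply: flow_contraction => //; exact: code_pt_in.
  by apply/rowP => i; rewrite !mxE; ring.
Qed.

Lemma cvg_approx_profile b m : 0 < b ->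
  (\int[@lebesgue_rV R n]_x (approx k0 N t x * sigmoid b m (approx k0 N t x))%:E)%E
    @[N --> \oo] -->
  (\int[@lebesgue_rV R n]_x
     (smoothed_density P s Y x * sigmoid b m (smoothed_density P s Y x))%:E)%E.
Proof.
move=> b0; have [G iG GP] := approx_dominated.
apply: (@dominated_cvg _ _ _ (@lebesgue_rV R n) setT measurableT
  (fun N x => (approx k0 N t x * sigmoid b m (approx k0 N t x))%:E) _ (EFin \o G)) => //.
- move=> N; apply/measurable_EFinP; apply: measurable_funM; first exact: measurable_mix.
  by apply: (measurableT_comp (measurable_sigmoid b m)); exact: measurable_mix.
- move=> x _; apply: cvg_EFin; first exact: nearW.
  apply: cvgM; first exact: cvg_approx.
  apply: continuous_cvg; last exact: cvg_approx.
  apply: differentiable_continuous; apply/derivable1_diffP.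
  by have [] := is_derive_sigmoid b m (smoothed_density P s Y x).
- move=> N x _; have /andP[a0 aG] := GP N x.
  have /andP[q0 q1] := sigmoid_ge0_le1 b m (approx k0 N t x).
  by rewrite /= lee_fin ger0_norm ?mulr_ge0// (le_trans _ aG)// ler_piMr.
Qed.

End fixed_time.
Lemma smoothed_profile_le t u (Y Y' : {RV P >-> 'rV[R]_n}) b m :
  0 <= t -> t <= u -> u <= 1 ->
  (forall w, Y w = T t (X w)) -> independent_rv P Y Z ->
  (forall w, Y' w = T u (X w)) -> independent_rv P Y' Z -> 0 < b ->
  profile_le (@lebesgue_rV R n) (smoothed_density P s Y) (smoothed_density P s Y')
    (sigmoid b m).
Proof.
move=> t0 tu u1 YE YZ Y'E Y'Z b0; have [k0 Kk0] := inhabited_sample_space.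
have t1 := le_trans tu u1; have u0 := le_trans t0 tu.
apply: (lee_cvg_to (@cvg_approx_profile k0 t Y Kk0 t0 t1 YE YZ b m b0)
  (@cvg_approx_profile k0 u Y' Kk0 u0 u1 Y'E Y'Z b m b0)).
apply: nearW => N; apply: finite_flow_profile_le => //; first exact: gprec_gt0.
- by move=> i; rewrite mulr_ge0 ?fine_ge0// ltW// gconst_gt0.
- by move=> i; exact: code_pt_in.
Qed.

End contraction_flow.

Unset Implicit Arguments.
Set Strict Implicit.
Set Printing Implicit Defensive.

Theorem theorem1p6 (R : realType) (n : nat) (K : set 'rV[R]_n)
  (T : R -> 'rV[R]_n -> 'rV[R]_n)
  (Tcontr : continuously_contracting K T)
  (Tsmooth : forall x, K x -> smooth_in `[0, 1] (fun t => T t x))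
  (d : measure_display) (Omega : measurableType d) (P : probability Omega R)
  (X Z : {RV P >-> 'rV[R]_n})
  (XK : forall w, K (X w))
  (EX : ('E_P[fun w => norm2 (X w)] < +oo)%E)
  (EdT : (\int[P]_w ereal_sup
            [set (norm2 (derive_in `[0, 1] (fun v => T v (X w)) t)%R)%:E
               | t in `[0%R, 1%R]%classic] < +oo)%E)
  (Zgauss : is_density P Z (@gauss_density R n))
  (XZ : independent_rv P X Z)
  (s : R) (s0 : 0 < s)
  (f : R -> 'rV[R]_n -> R)
  (fdens : forall t, 0 <= t -> t <= 1 ->
     is_density P (fun w => T t (X w) + Num.sqrt s *: Z w) (f t))
  (phi : R -> R)
  (phi_convex : convex_function (`[0, +oo[%classic : set R) phi)
  (phi0 : phi 0 = 0) :
  forall t u : R, 0 <= t -> t <= u -> u <= 1 ->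
    (\int[@lebesgue_rV R n]_x (phi (f t x))%:E
       <= \int[@lebesgue_rV R n]_x (phi (f u x))%:E)%E.
Proof.
move=> t u t0 tu u1; have t1 := le_trans tu u1; have u0 := le_trans t0 tu.
have [Yt YtE YtZ] := flow_RV Tcontr XK XZ t0 t1.
have [Yu YuE YuZ] := flow_RV Tcontr XK XZ u0 u1.
have smoothed (t' : R) (Y : {RV P >-> 'rV[R]_n}) : 0 <= t' -> t' <= 1 ->
    (forall w, Y w = T t' (X w)) -> independent_rv P Y Z ->
    is_density P (fun w => Y w + Num.sqrt s *: Z w) (smoothed_density P s Y) /\
    (\int[@lebesgue_rV R n]_x (phi (f t' x))%:E =
     \int[@lebesgue_rV R n]_x (phi (smoothed_density P s Y x))%:E)%E.
  move=> t'0 t'1 YE YZ; have dens := smoothed_density_is_density s0 Zgauss YZ.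
  split => //; have ft := fdens t' t'0 t'1.
  have WE : (fun w => T t' (X w) + Num.sqrt s *: Z w) =
            (fun w => Y w + Num.sqrt s *: Z w).
    by apply/funext => w; rewrite YE.
  rewrite WE in ft; have [mf f0 _] := ft.
  apply: ae_eq_integral => //.
  - by apply/measurable_EFinP; exact: measurable_convex_comp.
  - apply/measurable_EFinP; apply: measurable_convex_comp => //.
      exact: measurable_smoothed_density.
    by move=> x; exact: smoothed_density_ge0.
  - have := density_ae_eq ft dens; apply: filterS => x /(_ Logic.I) /= [->].
    by [].
have [dt ->] := smoothed t Yt t0 t1 YtE YtZ.
have [du ->] := smoothed u Yu u0 u1 YuE YuZ.
apply: (@convex_integral_le _ _ R (@lebesgue_rV R n) _ _ _ _ _ _ _ _ _ phi (gconst n s)) => //.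
- exact: measurable_smoothed_density.
- exact: measurable_smoothed_density.
- by move=> x; exact: smoothed_density_ge0.
- by move=> x; exact: smoothed_density_ge0.
- exact: density_integral1 dt.
- exact: density_integral1 du.
- by move=> b m b0; exact: (smoothed_profile_le Tcontr Tsmooth XK Zgauss s0 _ t0 tu u1).
- exact: gconst_gt0.
- by move=> x; exact: smoothed_density_le.
- by move=> x; exact: smoothed_density_le.
Qed.
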